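(* For $0<p<1/2$, there exists a singular inner function $S_\mu$ with $S_\mu'\notin H^p$ such that $$\int_{\{z\in\mathbb{D}:\ |S_\mu(z)|\le c\}}\frac{dA(z)}{(1-|z|)^{1+p}}<\infty$$ for any $0<c<1$.
   Context: $\mathbb{D}$ is the open unit disk, $\partial\mathbb{D}$ the unit circle, $dA$ is area measure, and $H^p$ is the Hardy space on $\mathbb{D}$. For a finite positive measure $\mu$ on $\partial\mathbb{D}$ singular with respect to Lebesgue measure, the singular inner function is $$S_\mu(z)=\exp\Bigl(-\int_{\partial\mathbb{D}}\frac{\zeta+z}{\zeta-z}\,d\mu(\zeta)\Bigr),\qquad |z|<1.$$ *)

(* Defs.v *)
From HB Require Import structures.
From mathcomp Require Export all_boot all_order all_algebra.
From mathcomp Require Export complex.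
From mathcomp Require Export all_classical all_reals all_analysis.

Set Implicit Arguments.
Unset Strict Implicit.
Unset Printing Implicit Defensive.

Import Order.TTheory GRing.Theory Num.Theory.
Import numFieldNormedType.Exports.

Local Open Scope classical_set_scope.
Local Open Scope ring_scope.
Local Open Scope complex_scope.

(* The unqualified names are those of [numClosedFieldType]. *)
Local Notation Re := complex.Re.
Local Notation Im := complex.Im.

Section SingularInner.
Context {R : realType}.

(* [R[i]] carries no measurable structure in the library, so measures on the
   complex plane live on the product measurable space [R * R] and points are
   moved to [R[i]] by [cplx]. *)
Definition plane : measurableType _ :=
  (measurableTypeR R * measurableTypeR R)%type.

Definition cplx (w : plane) : R[i] := w.1 +i* w.2.

Definition cnorm (z : R[i]) : R := ComplexField.Normc.normc z.

Definition cexp (z : R[i]) : R[i] :=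
  (expR (Re z))%:C * (cos (Im z) +i* sin (Im z)).

Definition area := (@lebesgue_measure R \x @lebesgue_measure R)%E.

Definition unit_circle : set plane := [set w | cnorm (cplx w) = 1].

Definition arc_length : set plane -> \bar R :=
  pushforward (mrestr (@lebesgue_measure R) (measurable_itv `[0, 2 * pi[))
              (fun t => (cos t, sin t) : plane).

Definition mutually_singular d (T : measurableType d)
    (mu nu : set T -> \bar R) : Prop :=
  exists A : set T, [/\ measurable A, mu A = 0%E & nu (~` A) = 0%E].

Definition cintegral d (T : measurableType d) (mu : {measure set T -> \bar R})
    (D : set T) (f : T -> R[i]) : R[i] :=
  (\int[mu]_(x in D) Re (f x)) +i* (\int[mu]_(x in D) Im (f x)).

Definition singular_inner (mu : {measure set plane -> \bar R}) (z : R[i]) : R[i] :=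
  cexp (- cintegral mu unit_circle
           (fun w => (cplx w + z) / (cplx w - z))).

(* Viewing [R[i]] as a [numFieldType] makes the library's [derivable] and
   [derive1] the complex derivative. *)
Let C : numFieldType := R[i].

Definition cderivable (f : R[i] -> R[i]) (z : R[i]) : Prop :=
  @derivable C C C^o f z 1.

Definition cderive (f : R[i] -> R[i]) : R[i] -> R[i] := @derive1 C C^o f.

Definition integral_mean (p : R) (f : R[i] -> R[i]) (r : R) : \bar R :=
  (((2 * pi)^-1)%:E *
   \int[@lebesgue_measure R]_(t in `[0%R, (2 * pi)%R])
     (cnorm (f (r%:C * cexp (0 +i* t))%R) `^ p)%:E)%E.

Definition Hardy (p : R) : set (R[i] -> R[i]) :=
  [set f | (forall z, cnorm z < 1 -> cderivable f z) /\
     (ereal_sup [set integral_mean p f r | r in `[0%R, 1%R[] < +oo)%E].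

End SingularInner.

(* Main.v *)
From HB Require Import structures.
From mathcomp Require Import measurable_realfun ring lra zify.
Require Import Defs.
Import Order.TTheory GRing.Theory Num.Theory.
Import numFieldNormedType.Exports.

Set Implicit Arguments.
Unset Strict Implicit.
Unset Printing Implicit Defensive.

Local Open Scope classical_set_scope.
Local Open Scope ring_scope.
Local Open Scope complex_scope.

Local Notation Re := complex.Re.
Local Notation Im := complex.Im.

(** The measure is a lacunary sum of stages. Stage [k] puts the same mass at each
    of the [N]-th roots of unity, [N = N_k], with total mass [A / N]. Summing
    the Herglotz kernel over roots of unity shows that the corresponding inner
    function is an atomic one evaluated at [w = z ^ N]: its exponent is
    [- (A / N) (1 + w) / (1 - w)] and the logarithmic derivative has modulus
    [2 A |z| ^ (N - 1) / |1 - w| ^ 2], which is at least of order [A] near the circle.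
    Its sublevel set is the preimage of a horodisk of size [A / N] under
    [z |-> z ^ N], which is covered by [N] horodisks of Euclidean size
    [A / N ^ 2]; the integral of [(1 - |z|) ^ (- 1 - p)] over a horodisk of
    size [h] is of order [h ^ (1 - p)] since [p < 1/2], so the stage costs
    [N (A / N ^ 2) ^ (1 - p) = A ^ (1 - p) N ^ (2 p - 1)]. As [2 p - 1 < 0],
    one may let [A] tend to infinity along the stages and still make these costs
    summable, by taking [N] a large power of [A]. Large [A] forces
    the means of [|S'| ^ p] to be unbounded, and summable costs give the
    integrability over every sublevel set.

    With [x_0 = 2] and [x_(k+1) = x_k ^ b], the choice is [A_k = x_k ^ a] and
    [N_k = x_(k+1)].

    Unbounded means: on the circle of radius [1 - 1 / N_k] the number
    [|z| ^ N_k] lies between [1/4] and [1/2], so stage [k] contributes at least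
    a multiple of [A_k] to the logarithmic derivative, and later stages contribute a bounded
    amount. The earlier stages are under control on a short arc, of length
    comparable to [1 / x_k], that stays away from all their atoms; there
    [Re F <= 5] and [|F'| >= A_k / 16] (lemmas [Re_herglotz_int_le5] and
    [herglotz_int_deriv_ge]), where [S = exp (- F)]. The arc is short, but
    [A_k ^ p / x_k] still tends to infinity when [a p >= 2].

    Sublevel sets: if [|S| <= c] then some stage has real part at least
    [2 ^ (- k - 2) log (1 / c)] (lemma [sublevel_cover]). For all but finitely
    many stages [preimage_horodisk] turns this into [N_k] small horodisks; for
    the remaining ones a pigeonhole argument over the atoms gives finitely many
    horodisks of some size, which suffices for finiteness. The weighted area of
    a horodisk is estimated by dyadic slicing in [1 - |z|]: a slice of depth [y]
    has width of order [sqrt (y h)], so its area is of order [y sqrt (y h)]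
    by integrating along lines (lemma [area_patch_near_le]). *)

(** * Complex numbers and the exponential *)

Section ComplexModulus.
Context {R : realType}.
Implicit Types (z w : R[i]) (x y : R).

Lemma cnorm_sqr z : cnorm z ^+ 2 = Re z ^+ 2 + Im z ^+ 2.
Proof. by case: z => a b; rewrite /cnorm /= sqr_sqrtr ?addr_ge0 ?sqr_ge0. Qed.

Lemma cnorm_ge0 z : 0 <= cnorm z.
Proof. by case: z => a b; rewrite /cnorm /= sqrtr_ge0. Qed.

Lemma cnormE z : `|z| = (cnorm z)%:C.
Proof. by case: z. Qed.

Lemma cnorm0 : cnorm (0 : R[i]) = 0.
Proof. exact: ComplexField.Normc.normc0. Qed.

Lemma cnorm1 : cnorm (1 : R[i]) = 1.
Proof. exact: ComplexField.Normc.normc1. Qed.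

Lemma cnormM z w : cnorm (z * w) = cnorm z * cnorm w.
Proof. exact: ComplexField.Normc.normcM. Qed.

Lemma cnormV z : cnorm z^-1 = (cnorm z)^-1.
Proof. exact: ComplexField.Normc.normcV. Qed.

Lemma cnormN z : cnorm (- z) = cnorm z.
Proof. exact: (@normcN R z). Qed.

Lemma cnormX z n : cnorm (z ^+ n) = cnorm z ^+ n.
Proof.
by elim: n => [|n IHn]; rewrite ?expr0 ?cnorm1// !exprS cnormM IHn.
Qed.

Lemma ler_cnormD z w : cnorm (z + w) <= cnorm z + cnorm w.
Proof. exact: (@le_normcD R z w). Qed.

Lemma ler_cnormB z w : cnorm (z - w) <= cnorm z + cnorm w.
Proof. by rewrite -(cnormN w) ler_cnormD. Qed.

Lemma lerB_cnorm z w : cnorm z - cnorm w <= cnorm (z - w).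
Proof. by rewrite lerBlDr -[leLHS](congr1 cnorm (subrK w z)) ler_cnormD. Qed.

Lemma cnormBC z w : cnorm (z - w) = cnorm (w - z).
Proof. by rewrite -cnormN opprB. Qed.

Lemma cnorm_eq0 z : (cnorm z == 0) = (z == 0).
Proof.
apply/eqP/eqP => [/ComplexField.Normc.eq0_normc//|->].
exact: cnorm0.
Qed.

Lemma cnorm_gt0 z : (0 < cnorm z) = (z != 0).
Proof. by rewrite lt_neqAle cnorm_ge0 andbT eq_sym cnorm_eq0. Qed.

Lemma cnormR x : cnorm (x%:C) = `|x|.
Proof. by rewrite /cnorm /= expr0n addr0 sqrtr_sqr. Qed.

Lemma ler_cnorm_sum (I : Type) (r : seq I) (P : pred I) (F : I -> R[i]) :
  cnorm (\sum_(i <- r | P i) F i) <= \sum_(i <- r | P i) cnorm (F i).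
Proof.
elim/big_ind2 : _ => [|a b c d ab cd|//]; first by rewrite cnorm0.
exact: le_trans (ler_cnormD _ _) (lerD ab cd).
Qed.

Lemma le_Re_cnorm z : `|Re z| <= cnorm z.
Proof.
rewrite -ler_sqr ?nnegrE ?cnorm_ge0//.
by rewrite -normrX ger0_norm ?sqr_ge0// cnorm_sqr lerDl sqr_ge0.
Qed.

Lemma le_Im_cnorm z : `|Im z| <= cnorm z.
Proof.
rewrite -ler_sqr ?nnegrE ?cnorm_ge0//.
by rewrite -normrX ger0_norm ?sqr_ge0// cnorm_sqr lerDr sqr_ge0.
Qed.

Lemma le_cnorm_ReIm z : cnorm z <= `|Re z| + `|Im z|.
Proof.
rewrite -ler_sqr ?nnegrE ?cnorm_ge0 ?addr_ge0//.
rewrite cnorm_sqr sqrrD !real_normK ?num_real//.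
rewrite -addrA lerD2l lerDr mulrn_wge0// mulr_ge0//.
Qed.

Lemma cReD z w : Re (z + w) = Re z + Re w. Proof. by case: z; case: w. Qed.
Lemma cImD z w : Im (z + w) = Im z + Im w. Proof. by case: z; case: w. Qed.
Lemma cReN z : Re (- z) = - Re z. Proof. by case: z. Qed.
Lemma cImN z : Im (- z) = - Im z. Proof. by case: z. Qed.
Lemma cReM z w : Re (z * w) = Re z * Re w - Im z * Im w.
Proof. by case: z; case: w. Qed.
Lemma cImM z w : Im (z * w) = Re z * Im w + Im z * Re w.
Proof. by case: z; case: w => *; rewrite /= addrC; ring. Qed.

Lemma cRe_sum (I : Type) (r : seq I) (P : pred I) (F : I -> R[i]) :
  Re (\sum_(i <- r | P i) F i) = \sum_(i <- r | P i) Re (F i).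
Proof. exact: (big_morph (@complex.Re R) cReD (erefl _)). Qed.

Lemma cIm_sum (I : Type) (r : seq I) (P : pred I) (F : I -> R[i]) :
  Im (\sum_(i <- r | P i) F i) = \sum_(i <- r | P i) Im (F i).
Proof. exact: (big_morph (@complex.Im R) cImD (erefl _)). Qed.

Lemma cReV z : Re z^-1 = Re z / (cnorm z ^+ 2).
Proof. by rewrite cnorm_sqr; case: z => a b /=. Qed.

Lemma cImV z : Im z^-1 = - Im z / (cnorm z ^+ 2).
Proof. by rewrite cnorm_sqr; case: z => a b /=; rewrite mulNr. Qed.

Lemma complex_ext z w : Re z = Re w -> Im z = Im w -> z = w.
Proof. by case: z; case: w => a b c d /= -> ->. Qed.

Lemma cReMr x z : Re (x%:C * z) = x * Re z.
Proof. by rewrite cReM /= mul0r subr0. Qed.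

Lemma cImMr x z : Im (x%:C * z) = x * Im z.
Proof. by rewrite cImM /= mul0r addr0. Qed.

End ComplexModulus.

Section ComplexExponential.
Context {R : realType}.
Implicit Types (z w : R[i]) (x y : R).

Lemma cexpD z w : cexp (z + w) = cexp z * cexp w.
Proof.
case: z => a b; case: w => c d; apply: complex_ext;
  rewrite /cexp !(cReM, cImM, cReD, cImD)/= expRD ?cosD ?sinD; ring.
Qed.

Lemma cexp0 : cexp (0 : R[i]) = 1.
Proof.
by apply: complex_ext; rewrite /cexp !(cReM, cImM)/= expR0 cos0 sin0; ring.
Qed.

Lemma cexpMn z n : cexp (z *+ n) = cexp z ^+ n.
Proof. by elim: n => [|n IHn]; rewrite ?mulr0n ?cexp0// mulrS cexpD IHn exprS. Qed.

Lemma cnorm_cexp z : cnorm (cexp z) = expR (Re z).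
Proof.
apply/eqP; rewrite -(@eqrXn2 _ 2)// ?cnorm_ge0 ?expR_ge0//.
rewrite cnorm_sqr /cexp !(cReM, cImM)/=.
have := cos2Dsin2 (Im z) => h.
apply/eqP; transitivity (expR (Re z) ^+ 2 * (cos (Im z) ^+ 2 + sin (Im z) ^+ 2)).
  by ring.
by rewrite h mulr1.
Qed.

(** The sine and the arctangent satisfy [|f x| <= |x|] for this common reason. *)
Lemma mvt_abs_le (f df : R -> R) (x : R) : f 0 = 0 ->
  (forall y, is_derive y 1 f (df y)) -> (forall y, `|df y| <= 1) ->
  `|f x| <= `|x|.
Proof.
move=> f0 fd dfb.
have cf : continuous f.
  move=> y; apply: differentiable_continuous; apply/derivable1_diffP.
  exact: (@ex_derive _ _ _ _ _ _ _ (fd y)).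
case: (ltrgtP x 0) => [x0|x0|->]; last by rewrite f0.
  have [//|c _] := @MVT _ f df x 0 x0 (fun y _ => fd y).
    exact: continuous_subspaceT.
  rewrite f0 !sub0r => /(congr1 Num.norm); rewrite normrN => ->.
  by rewrite normrM normrN ler_piMl.
have [//|c _] := @MVT _ f df 0 x x0 (fun y _ => fd y).
  exact: continuous_subspaceT.
rewrite f0 !subr0 => ->.
by rewrite normrM ler_piMl.
Qed.

Lemma ler_abs_sin x : `|sin x| <= `|x|.
Proof.
apply: (@mvt_abs_le _ cos) => [|y]; first exact: sin0.
exact: cos_max.
Qed.

Lemma ler_abs_atan x : `|atan x| <= `|x|.
Proof.
apply: (@mvt_abs_le _ (fun y => (1 + y ^+ 2)^-1)) => [|y]; first exact: atan0.
have h : 0 < 1 + y ^+ 2 by rewrite ltr_pwDl ?sqr_ge0.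
have hi : 0 <= (1 + y ^+ 2)^-1 by rewrite invr_ge0 ltW.
by rewrite ger0_norm// invf_le1// lerDl sqr_ge0.
Qed.

Lemma cosB1_half x : 1 - cos x = 2 * sin (x / 2) ^+ 2.
Proof.
have -> : cos x = cos ((x / 2) *+ 2) by congr cos; rewrite mulr2n; lra.
by rewrite cos_mulr2n cos2sin2 mulr2n; ring.
Qed.

Lemma ler_1Bcos x : 1 - cos x <= x ^+ 2 / 2.
Proof.
rewrite cosB1_half.
have h : sin (x / 2) ^+ 2 <= (x / 2) ^+ 2.
  rewrite -[leLHS]real_normK ?num_real// -[leRHS]real_normK ?num_real//.
  by rewrite ler_sqr ?nnegrE// ler_abs_sin.
by move: h; set s := sin _ ^+ 2; move=> h; nra.
Qed.

(** The chord is shorter than the arc: [|e^(ix) - 1| ^ 2 = 2 (1 - cos x) <= x ^ 2]. *)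
Lemma cnorm_cis_sub1 x : cnorm (cexp (0 +i* x) - 1) <= `|x|.
Proof.
rewrite -ler_sqr ?nnegrE ?cnorm_ge0//.
rewrite cnorm_sqr /cexp !(cReM, cImM, cReD, cImD, cReN, cImN)/= expR0.
have := cos2Dsin2 x; have := ler_1Bcos x.
rewrite real_normK ?num_real//.
by nra.
Qed.

End ComplexExponential.

Section ComplexDerivative.
Context {R : realType}.
Implicit Types (z w h : R[i]) (x y : R).

Lemma expR_sub1_sub_le x : `|x| <= 2^-1 -> `|expR x - 1 - x| <= 2 * x ^+ 2.
Proof.
rewrite ler_norml => /andP[xl xu].
have e1 := expR_ge1Dx x.
have := expR_ge1Dx (- x).
have ex := expR_gt0 x; have e2 := expRxMexpNx_1 x.
rewrite ger0_norm; last by lra.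
move=> e3.
have h : expR x * (1 - x) <= 1 by rewrite -[leRHS]e2 ler_pM2l.
have : 0 <= (expR x - 1 - x) * (2^-1 - x) by rewrite mulr_ge0// subr_ge0; lra.
set e := expR x in h e1 *; nra.
Qed.

Lemma sin_sub_le x : `|sin x - x| <= x ^+ 2.
Proof.
pose f (y : R) : R := sin y - y.
have fd (y : R) : is_derive y 1 f (cos y - 1).
  by apply: is_deriveB.
have cf : continuous f.
  move=> y; apply: differentiable_continuous; apply/derivable1_diffP.
  exact: (@ex_derive _ _ _ _ _ _ _ (fd y)).
have cosb (c : R) : `|cos c - 1| <= `|c|.
  have := cnorm_cis_sub1 c; apply: le_trans.
  apply: le_trans (le_Re_cnorm _).
  by rewrite /cexp !(cReM, cReD, cReN)/= expR0 mul0r subr0 mul1r.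
have key (y : R) : 0 < y -> `|f y| <= y ^+ 2.
  move=> y0.
  have [|c] := @MVT _ f (fun y => cos y - 1) 0 y y0 (fun y _ => fd y).
    exact: continuous_subspaceT.
  rewrite in_itv/= => /andP[c0 cy].
  rewrite /f sin0 !subr0 => ->.
  rewrite normrM expr2 (gtr0_norm y0) ler_wpM2r ?(ltW y0)//.
  by rewrite (le_trans (cosb c))// gtr0_norm// ltW.
case: (ltrgtP x 0) => [x0|x0|->]; last by rewrite sin0 subr0 normr0 expr0n.
  have := key (- x); rewrite oppr_gt0 => /(_ x0).
  by rewrite /f sinN sqrrN -opprD normrN.
exact: key.
Qed.

(** The quadratic remainder follows from
    [e^x c - 1 - x - iy = (e^x - 1 - x) c + (1 + x) (c - 1 - iy) + ixy],
    where [c] is the point of the unit circle with argument [y]. *)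
Lemma cexp_sub1_sub_le h : cnorm h <= 2^-1 ->
  cnorm (cexp h - 1 - h) <= 6 * cnorm h ^+ 2.
Proof.
move=> hh.
have xh := le_Re_cnorm h; have yh := le_Im_cnorm h.
have x2 : Re h ^+ 2 <= cnorm h ^+ 2 by rewrite cnorm_sqr lerDl sqr_ge0.
have y2 : Im h ^+ 2 <= cnorm h ^+ 2 by rewrite cnorm_sqr lerDr sqr_ge0.
have xhh := le_trans xh hh.
set c := cexp (0 +i* Im h).
have c1 : cnorm c = 1 by rewrite cnorm_cexp/= expR0.
have -> : cexp h - 1 - h = (expR (Re h) - 1 - Re h)%:C * c
   + (1 + Re h)%:C * (c - 1 - (0 +i* Im h)) + (Re h)%:C * (0 +i* Im h).
  rewrite /c; apply: complex_ext;
  rewrite /cexp !(cReM, cImM, cReD, cImD, cReN, cImN)/= expR0; ring.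
have b1 : cnorm ((expR (Re h) - 1 - Re h)%:C * c) <= 2 * cnorm h ^+ 2.
  rewrite cnormM c1 mulr1 cnormR (le_trans (expR_sub1_sub_le xhh))//.
  by rewrite ler_pM2l.
have b2 : cnorm (c - 1 - (0 +i* Im h)) <= 2 * cnorm h ^+ 2.
  apply: (le_trans (le_cnorm_ReIm _)).
  rewrite /c /cexp !(cReM, cImM, cReD, cImD, cReN, cImN)/= expR0.
  have := sin_sub_le (Im h); have := ler_1Bcos (Im h); have := cos_le1 (Im h).
  rewrite -[X in _ -> _ -> _ -> `|X| + _ <= _]opprK normrN.
  move=> k1 k2 k3; rewrite ger0_norm; last by lra.
  have -> : 1 * sin (Im h) + 0 * cos (Im h) - 0 - Im h = sin (Im h) - Im h.
    by ring.
  have : 0 <= Im h ^+ 2 by rewrite sqr_ge0.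
  lra.
have b3 : cnorm ((Re h)%:C * (0 +i* Im h)) <= cnorm h ^+ 2.
  rewrite cnormM cnormR expr2 ler_pM// ?cnorm_ge0//.
  by rewrite (le_trans (le_cnorm_ReIm _))//= normr0 add0r.
apply: (le_trans (ler_cnormD _ _)).
have -> : 6 * cnorm h ^+ 2 = (2 * cnorm h ^+ 2 + (3/2) * (2 * cnorm h ^+ 2))
    + cnorm h ^+ 2 by field.
apply: lerD b3; apply: (le_trans (ler_cnormD _ _)); apply: lerD b1 _.
rewrite cnormM cnormR ler_pM// ?cnorm_ge0//.
by rewrite (le_trans (ler_normD _ _))// normr1; lra.
Qed.

(** All the complex derivatives below are obtained from explicit quadratic
    remainders: those of the Herglotz kernel are uniform over the circle, so
    they can be integrated. *)
Lemma cderiveP (f : R[i] -> R[i]) z d (B rho : R) : 0 < rho ->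
  (forall h, cnorm h < rho ->
     cnorm (f (z + h) - f z - h * d) <= B * cnorm h ^+ 2) ->
  cderivable f z /\ cderive f z = d.
Proof.
move=> rho0 H.
pose C : numFieldType := R[i].
have B0 : 0 <= `|B| + 1 by rewrite addr_ge0.
have key : (fun t : C => t^-1 *: ((f \o shift z) (t *: (1 : C)) - f z : C^o))
             @ (0 : C)^' --> (d : C^o).
  apply/cvgrPdist_le => e e0.
  have eRe : e = (Re e)%:C.
    by move: e0; case: e => a b; rewrite ltcE/= => /andP[/eqP -> _].
  have e0' : 0 < Re e by move: e0; rewrite eRe ltcR.
  (* Below this radius [B |t| <= e]; the summand [1] avoids a division by zero. *)
  pose dl := Num.min rho (Re e / (`|B| + 1)).
  have dl0 : 0 < dl by rewrite lt_min rho0 divr_gt0// ltr_wpDl.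
  exists (dl%:C : C) => /=; first by rewrite ltcR.
  move=> t /=; rewrite sub0r normrN cnormE ltcR => tdl t0.
  have tn0 : 0 < cnorm (t : R[i]) by rewrite cnorm_gt0.
  rewrite [t%:A]/(_ *: _) /= .
  have -> : (d - t^-1 *: (f (t *: (1 : C) + z) - f z) : C)
     = - (t^-1 * (f (z + t) - f z - t * d)).
    rewrite /GRing.scale/= mulr1 (addrC t z).
    rewrite [RHS](_ : _ = d * (t^-1 * t) - t^-1 * (f (z + t) - f z)); last by ring.
    by rewrite mulVf// mulr1.
  rewrite normrN cnormE eRe lecR cnormM cnormV.
  move: tdl; rewrite lt_min => /andP[trho te].
  rewrite ler_pdivrMl// (le_trans (H _ trho))//.
  rewrite expr2 mulrCA ler_wpM2l ?cnorm_ge0//.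
  rewrite (@le_trans _ _ ((`|B| + 1) * cnorm (t : R[i])))//.
    by rewrite ler_wpM2r ?cnorm_ge0// (le_trans (ler_norm B))// lerDl.
  by rewrite mulrC -ler_pdivlMr ?ltW// ltr_wpDl.
split.
  by apply/cvg_ex; exists (d : C^o); exact: key.
rewrite /cderive derive1E /derive.
exact: (cvg_lim _ key).
Qed.

End ComplexDerivative.

(** * Integrals of bounded complex functions over the circle *)

Section ComplexMeasurable.
Context {R : realType} d (T : measurableType d).
Implicit Types (f g : T -> R[i]) (u : T -> R).

Definition cmeasurable f : Prop :=
  measurable_fun setT (fun w => Re (f w)) /\
  measurable_fun setT (fun w => Im (f w)).

Lemma measurable_funV_ge0 u : (forall x, 0 <= u x) -> measurable_fun setT u ->
  measurable_fun setT (fun x => (u x)^-1).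
Proof.
move=> u0 mu.
rewrite (_ : (fun x => (u x)^-1) = (fun x => u x `^ (-1))).
  by apply: (measurableT_comp (measurable_powR (-1))).
by apply/funext => x; rewrite powR_inv1.
Qed.

Lemma cmeasurable_cst z : cmeasurable (fun=> z).
Proof. by split; exact: measurable_cst. Qed.

Lemma cmeasurableD f g : cmeasurable f -> cmeasurable g ->
  cmeasurable (fun w => f w + g w).
Proof.
move=> [f1 f2] [g1 g2]; split; under eq_fun do rewrite ?cReD ?cImD;
  exact: measurable_funD.
Qed.

Lemma cmeasurableN f : cmeasurable f -> cmeasurable (fun w => - f w).
Proof.
move=> [f1 f2]; split; under eq_fun do rewrite ?cReN ?cImN;
  exact: measurable_funN.
Qed.

Lemma cmeasurableB f g : cmeasurable f -> cmeasurable g ->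
  cmeasurable (fun w => f w - g w).
Proof. by move=> mf mg; apply: cmeasurableD => //; exact: cmeasurableN. Qed.

Lemma cmeasurableM f g : cmeasurable f -> cmeasurable g ->
  cmeasurable (fun w => f w * g w).
Proof.
move=> [f1 f2] [g1 g2]; split.
  under eq_fun do rewrite cReM.
  by apply: measurable_funB; apply: measurable_funM.
under eq_fun do rewrite cImM.
by apply: measurable_funD; apply: measurable_funM.
Qed.

Lemma measurable_cnorm2 f : cmeasurable f ->
  measurable_fun setT (fun w => cnorm (f w) ^+ 2).
Proof.
move=> [f1 f2]; under eq_fun do rewrite cnorm_sqr.
by apply: measurable_funD; apply: measurable_funX.
Qed.

Lemma measurable_cnorm f : cmeasurable f ->
  measurable_fun setT (fun w => cnorm (f w)).
Proof.
move=> /measurable_cnorm2 mf.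
rewrite (_ : (fun w => cnorm (f w)) = (fun w => (cnorm (f w) ^+ 2) `^ 2^-1)).
  by apply: (measurableT_comp (measurable_powR 2^-1)).
by apply/funext => x; rewrite powR12_sqrt ?sqr_ge0// sqrtr_sqr ger0_norm ?cnorm_ge0.
Qed.

Lemma cmeasurableV f : cmeasurable f -> cmeasurable (fun w => (f w)^-1).
Proof.
move=> mf; have := measurable_cnorm2 mf; case: mf => f1 f2 fn.
have fnV : measurable_fun setT (fun w => (cnorm (f w) ^+ 2)^-1).
  by apply: measurable_funV_ge0 => // x; exact: sqr_ge0.
split; under eq_fun do rewrite ?cReV ?cImV; apply: measurable_funM => //.
exact: measurable_funN.
Qed.

End ComplexMeasurable.

Section CircleIntegral.
Context {R : realType}.
Implicit Types (f g : @plane R -> R[i]) (z : R[i]).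

Lemma cmeasurable_cplx : cmeasurable (@cplx R).
Proof.
split => /=; first exact: (@measurable_fst _ _ (measurableTypeR R) (measurableTypeR R)).
exact: (@measurable_snd _ _ (measurableTypeR R) (measurableTypeR R)).
Qed.

Lemma measurable_unit_circle : measurable (@unit_circle R).
Proof.
rewrite (_ : unit_circle = setT `&` (fun w : plane => cnorm (cplx w)) @^-1` [set 1]).
  by apply: (measurable_cnorm cmeasurable_cplx) => //; exact: measurable_set1.
by rewrite setTI.
Qed.

Context (mu : {finite_measure set (@plane R) -> \bar R}).

Local Notation total := (fine (mu unit_circle)).

Lemma total_ge0 : 0 <= total.
Proof. by rewrite fine_ge0. Qed.

Definition circle_bounded f (B : R) : Prop :=
  forall w, unit_circle w -> cnorm (f w) <= B.

Lemma bounded_circle_integrable (u : plane -> R) (B : R) :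
  measurable_fun setT u -> (forall w, unit_circle w -> `|u w| <= B) ->
  mu.-integrable unit_circle (EFin \o u).
Proof.
move=> mu_ ub; apply: measurable_bounded_integrable.
- exact: measurable_unit_circle.
- by rewrite ltey_eq fin_num_measure//; exact: measurable_unit_circle.
- exact: measurable_funTS.
- exists B; split; first exact: num_real.
  by move=> x Bx w /ub /= uw; rewrite (le_trans uw)// ltW.
Qed.

Lemma circle_integrable_Re f B : cmeasurable f -> circle_bounded f B ->
  mu.-integrable unit_circle (EFin \o (fun w => Re (f w))).
Proof.
move=> [mf _] fb; apply: (@bounded_circle_integrable _ B) => // w /fb.
exact/le_trans/le_Re_cnorm.
Qed.

Lemma circle_integrable_Im f B : cmeasurable f -> circle_bounded f B ->
  mu.-integrable unit_circle (EFin \o (fun w => Im (f w))).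
Proof.
move=> [_ mf] fb; apply: (@bounded_circle_integrable _ B) => // w /fb.
exact/le_trans/le_Im_cnorm.
Qed.

Lemma le_abs_circle_Rintegral (u : plane -> R) (B : R) :
  measurable_fun setT u -> (forall w, unit_circle w -> `|u w| <= B) ->
  `|\int[mu]_(w in unit_circle) u w| <= B * total.
Proof.
move=> mu_ ub.
have iu := bounded_circle_integrable mu_ ub.
have mU := measurable_unit_circle.
apply: (le_trans (le_normr_Rintegral mU iu)).
rewrite -Rintegral_cst//; apply: le_Rintegral => //.
- apply: (@bounded_circle_integrable (fun w => `|u w|) B).
    exact: measurableT_comp.
  by move=> w /ub; rewrite normr_id.
- apply: (@bounded_circle_integrable (fun=> B) `|B|) => //.
Qed.

Lemma le_cnorm_cintegral f B : cmeasurable f -> circle_bounded f B ->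
  cnorm (cintegral mu unit_circle f) <= 2 * B * total.
Proof.
move=> [mf1 mf2] fb.
apply: (le_trans (le_cnorm_ReIm _)) => /=.
rewrite -mulrA mulr2n mulrDl mul1r; apply: lerD.
  by apply: le_abs_circle_Rintegral => // w /fb; exact/le_trans/le_Re_cnorm.
by apply: le_abs_circle_Rintegral => // w /fb; exact/le_trans/le_Im_cnorm.
Qed.

Lemma cintegralB f g B B' : cmeasurable f -> circle_bounded f B ->
  cmeasurable g -> circle_bounded g B' ->
  cintegral mu unit_circle (fun w => f w - g w) =
  cintegral mu unit_circle f - cintegral mu unit_circle g.
Proof.
move=> mf bf mg bg.
have mU := measurable_unit_circle.
apply: complex_ext => /=.
  rewrite -RintegralB//; last 2 first.
    exact: circle_integrable_Re bf.
    exact: circle_integrable_Re bg.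
  by apply: eq_Rintegral => w _; rewrite cReD cReN.
rewrite -RintegralB//; last 2 first.
  exact: circle_integrable_Im bf.
  exact: circle_integrable_Im bg.
by apply: eq_Rintegral => w _; rewrite cImD cImN.
Qed.

Lemma cintegralZ z f B : cmeasurable f -> circle_bounded f B ->
  cintegral mu unit_circle (fun w => z * f w) =
  z * cintegral mu unit_circle f.
Proof.
move=> mf bf.
have mU := measurable_unit_circle.
have iR := circle_integrable_Re mf bf.
have iI := circle_integrable_Im mf bf.
have [m1 m2] := mf.
have b1 w : unit_circle w -> `|Re (f w)| <= B.
  by move=> /bf; exact/le_trans/le_Re_cnorm.
have b2 w : unit_circle w -> `|Im (f w)| <= B.
  by move=> /bf; exact/le_trans/le_Im_cnorm.
have sc (c : R) (u : plane -> R) : measurable_fun setT u ->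
    (forall w, unit_circle w -> `|u w| <= B) ->
    mu.-integrable unit_circle (EFin \o (fun w => c * u w)).
  move=> mu_ ub; apply: (@bounded_circle_integrable _ (`|c| * B)).
    by apply: measurable_funM => //; exact: measurable_cst.
  by move=> w /ub uw; rewrite normrM ler_wpM2l.
apply: complex_ext.
  rewrite cReM /= -!RintegralZl// -RintegralB//; try exact: sc.
  by apply: eq_Rintegral => w _; rewrite cReM.
rewrite cImM /= -!RintegralZl// -RintegralD//; try exact: sc.
by apply: eq_Rintegral => w _; rewrite cImM.
Qed.

End CircleIntegral.

(** * The complex derivative of a singular inner function *)

Section SingularInnerDerivative.
Context {R : realType}.
Implicit Types (z h : R[i]).

(** The Herglotz kernel; its real part is the Poisson kernel. *)
Definition herglotz z (w : @plane R) : R[i] := (cplx w + z) / (cplx w - z).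

(** The derivative of the Herglotz kernel with respect to [z]. *)
Definition herglotz_deriv z (w : @plane R) : R[i] :=
  2%:R * cplx w / (cplx w - z) ^+ 2.

Lemma cmeasurable_Bcplx z : cmeasurable (fun w : @plane R => cplx w - z).
Proof. by apply: cmeasurableB; [exact: cmeasurable_cplx|exact: cmeasurable_cst]. Qed.

Lemma cmeasurable_herglotz z : cmeasurable (herglotz z).
Proof.
apply: cmeasurableM; last by apply: cmeasurableV; exact: cmeasurable_Bcplx.
by apply: cmeasurableD; [exact: cmeasurable_cplx|exact: cmeasurable_cst].
Qed.

Lemma cmeasurable_herglotz_deriv z : cmeasurable (herglotz_deriv z).
Proof.
apply: cmeasurableM; last first.
  apply: cmeasurableV; under [X in cmeasurable X]eq_fun do rewrite expr2.
  by apply: cmeasurableM; exact: cmeasurable_Bcplx.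
by apply: cmeasurableM; [exact: cmeasurable_cst|exact: cmeasurable_cplx].
Qed.

Lemma ge_cnorm_Bcplx z (w : @plane R) : unit_circle w ->
  1 - cnorm z <= cnorm (cplx w - z).
Proof. by move=> <-; exact: lerB_cnorm. Qed.

Lemma Bcplx_neq0 z (w : @plane R) : cnorm z < 1 -> unit_circle w ->
  cplx w - z != 0.
Proof.
move=> z1 /ge_cnorm_Bcplx => /(_ z) h.
by rewrite -cnorm_gt0 (lt_le_trans _ h)// subr_gt0.
Qed.

Lemma cnormn n : cnorm (n%:R : R[i]) = n%:R.
Proof. by rewrite -(rmorph_nat (real_complex R)) cnormR ger0_norm. Qed.

Lemma circle_bounded_herglotz z : cnorm z < 1 ->
  circle_bounded (herglotz z) (2 / (1 - cnorm z)).
Proof.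
move=> z1 w uw; have d := ge_cnorm_Bcplx z uw.
have d0 : 0 < 1 - cnorm z by rewrite subr_gt0.
rewrite cnormM cnormV ler_pM ?cnorm_ge0 ?invr_ge0 ?cnorm_ge0//.
  by rewrite (le_trans (ler_cnormD _ _))// uw; lra.
by rewrite lef_pV2 ?posrE// (lt_le_trans d0).
Qed.

Lemma circle_bounded_herglotz_deriv z : cnorm z < 1 ->
  circle_bounded (herglotz_deriv z) (2 / (1 - cnorm z) ^+ 2).
Proof.
move=> z1 w uw; have d := ge_cnorm_Bcplx z uw.
have d0 : 0 < 1 - cnorm z by rewrite subr_gt0.
have d1 := lt_le_trans d0 d.
rewrite !cnormM cnormV cnormX uw mulr1 cnormn ler_wpM2l//.
by rewrite lef_pV2 ?posrE ?exprn_gt0// ler_sqr ?nnegrE ?(ltW d0) ?(ltW d1).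
Qed.

(** The remainder is exactly [2 w h ^ 2 / ((w - z) ^ 2 (w - z - h))], and both
    denominators stay away from zero while [|h| <= (1 - |z|) / 2]. *)
Lemma herglotz_remainder z h (w : @plane R) : cnorm z < 1 ->
  cnorm h <= (1 - cnorm z) / 2 -> unit_circle w ->
  cnorm (herglotz (z + h) w - herglotz z w - h * herglotz_deriv z w) <=
  4 / (1 - cnorm z) ^+ 3 * cnorm h ^+ 2.
Proof.
move=> z1 hz uw.
have d0 : 0 < 1 - cnorm z by rewrite subr_gt0.
have zh1 : cnorm (z + h) < 1 by rewrite (le_lt_trans (ler_cnormD _ _))//; lra.
have n1 := Bcplx_neq0 z1 uw; have n2 := Bcplx_neq0 zh1 uw.
have d1 := ge_cnorm_Bcplx z uw; have d2 := ge_cnorm_Bcplx (z + h) uw.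
have d2' : (1 - cnorm z) / 2 <= cnorm (cplx w - (z + h)).
  by apply: le_trans d2; have := ler_cnormD z h; lra.
have -> : herglotz (z + h) w - herglotz z w - h * herglotz_deriv z w =
    2%:R * cplx w * h ^+ 2 / ((cplx w - z) ^+ 2 * (cplx w - (z + h))).
  by rewrite /herglotz /herglotz_deriv; field; rewrite n1 n2.
rewrite cnormM cnormV (cnormM _ (h ^+ 2)) (cnormM _ (cplx w)).
rewrite (cnormM (_ ^+ 2)) !cnormX uw cnormn mulr1.
rewrite mulrAC ler_wpM2r ?sqr_ge0//.
have -> : 4 / (1 - cnorm z) ^+ 3 = 2 / ((1 - cnorm z) ^+ 2 * ((1 - cnorm z) / 2)).
  by field; lra.
have c1 := lt_le_trans d0 d1.
have c2 : 0 < cnorm (cplx w - (z + h)) by apply: lt_le_trans d2'; rewrite divr_gt0.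
rewrite ler_wpM2l// lef_pV2 ?posrE ?mulr_gt0 ?exprn_gt0 ?invr_gt0//.
rewrite ler_pM ?exprn_ge0 ?divr_ge0 ?(ltW d0)//.
by rewrite ler_sqr ?nnegrE ?cnorm_ge0 ?(ltW d0).
Qed.

Context (mu : {finite_measure set (@plane R) -> \bar R}).
Local Notation total := (fine (mu unit_circle)).

Definition herglotz_int z : R[i] := cintegral mu unit_circle (herglotz z).
Definition herglotz_int_deriv z : R[i] :=
  cintegral mu unit_circle (herglotz_deriv z).

Lemma herglotz_int_remainder z h : cnorm z < 1 ->
  cnorm h <= (1 - cnorm z) / 2 ->
  cnorm (herglotz_int (z + h) - herglotz_int z - h * herglotz_int_deriv z) <=
  (8 / (1 - cnorm z) ^+ 3 * total) * cnorm h ^+ 2.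
Proof.
move=> z1 hz.
have d0 : 0 < 1 - cnorm z by rewrite subr_gt0.
have zh1 : cnorm (z + h) < 1 by rewrite (le_lt_trans (ler_cnormD _ _))//; lra.
have b1 := circle_bounded_herglotz z1; have b2 := circle_bounded_herglotz zh1.
have b3 := circle_bounded_herglotz_deriv z1.
have m1 := cmeasurable_herglotz z; have m2 := cmeasurable_herglotz (z + h).
have m3 := cmeasurable_herglotz_deriv z.
rewrite -(cintegralZ mu h m3 b3) -(cintegralB mu m2 b2 m1 b1).
have m4 : cmeasurable (fun w => h * herglotz_deriv z w).
  by apply: cmeasurableM => //; exact: cmeasurable_cst.
have b4 : circle_bounded (fun w => h * herglotz_deriv z w)
    (cnorm h * (2 / (1 - cnorm z) ^+ 2)).
  by move=> w /b3 bw; rewrite cnormM ler_wpM2l ?cnorm_ge0.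
have m5 := cmeasurableB m2 m1.
have b5 : circle_bounded (fun w => herglotz (z + h) w - herglotz z w)
    (2 / (1 - cnorm (z + h)) + 2 / (1 - cnorm z)).
  by move=> w uw; rewrite (le_trans (ler_cnormB _ _))// lerD// ?b1 ?b2.
rewrite -(cintegralB mu m5 b5 m4 b4).
have -> : 8 / (1 - cnorm z) ^+ 3 * total * cnorm h ^+ 2 =
    2 * (4 / (1 - cnorm z) ^+ 3 * cnorm h ^+ 2) * total by field; lra.
apply: le_cnorm_cintegral; first exact: cmeasurableB.
by move=> w uw; exact: herglotz_remainder.
Qed.

(** The chain rule for [exp (- F)], with the quadratic remainders of the
    exponential and of the Herglotz integral [F]. *)
Lemma cderive_singular_inner z : cnorm z < 1 ->
  cderivable (singular_inner mu) z /\
  cderive (singular_inner mu) z = - (singular_inner mu z * herglotz_int_deriv z).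
Proof.
move=> z1.
have d0 : 0 < 1 - cnorm z by rewrite subr_gt0.
set F' := herglotz_int_deriv z; set S := singular_inner mu.
pose B1 := 8 / (1 - cnorm z) ^+ 3 * total.
have B10 : 0 <= B1.
  by rewrite mulr_ge0 ?total_ge0// divr_ge0// exprn_ge0// ltW.
pose L := cnorm F' + B1 + 1.
have L1 : 1 <= L by rewrite /L; have := cnorm_ge0 F'; lra.
have L0 : 0 < L by lra.
pose rho := Num.min ((1 - cnorm z) / 2) (2 * L)^-1.
apply: (@cderiveP _ _ _ _ (cnorm (S z) * (6 * L ^+ 2 + B1)) rho).
  by rewrite lt_min divr_gt0//= invr_gt0 mulr_gt0.
move=> h; rewrite lt_min => /andP[h1 h2].
have hL : cnorm h * L <= 2^-1.
  have : cnorm h * (2 * L) <= 1.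
    by rewrite -ler_pdivlMr ?mulr_gt0// mul1r ltW.
  lra.
have hle1 : cnorm h <= 1.
  by have := cnorm_ge0 h; nra.
pose dl := herglotz_int (z + h) - herglotz_int z.
have rem := herglotz_int_remainder z1 (ltW h1).
rewrite -/dl -/F' -/B1 in rem.
have dlL : cnorm dl <= cnorm h * L.
  have -> : dl = (dl - h * F') + h * F' by rewrite subrK.
  rewrite (le_trans (ler_cnormD _ _))// cnormM (le_trans (lerD rem (lexx _)))//.
  have : B1 * cnorm h ^+ 2 <= cnorm h * B1.
    by rewrite mulrC expr2 -mulrA ler_wpM2l ?cnorm_ge0// ler_piMl.
  rewrite /L !mulrDr mulr1; have := cnorm_ge0 h; lra.
have dlh : cnorm (- dl) <= 2^-1 by rewrite cnormN (le_trans dlL).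
have SE : S (z + h) = S z * cexp (- dl).
  rewrite /S /singular_inner -/(herglotz_int (z + h)) -/(herglotz_int z) -cexpD.
  by congr cexp; rewrite /dl; ring.
have -> : S (z + h) - S z - h * - (S z * F') =
    S z * ((cexp (- dl) - 1 - (- dl)) - (dl - h * F')).
  by rewrite SE; ring.
rewrite cnormM -mulrA ler_wpM2l ?cnorm_ge0//.
rewrite (le_trans (ler_cnormB _ _))// mulrDl lerD//.
rewrite (le_trans (cexp_sub1_sub_le dlh))// cnormN -mulrA ler_wpM2l//.
by rewrite -exprMn mulrC ler_sqr ?nnegrE ?mulr_ge0 ?cnorm_ge0// ltW.
Qed.

Lemma cnorm_singular_inner z :
  cnorm (singular_inner mu z) = expR (- Re (herglotz_int z)).
Proof. by rewrite cnorm_cexp cReN. Qed.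

End SingularInnerDerivative.

(** * Countable families of equally spaced atoms *)

Section AtomicMeasure.
Context {R : realType}.

Definition root_angle (n j : nat) : R := 2 * pi * j%:R / n%:R.

Definition root_point (n j : nat) : @plane R :=
  (cos (root_angle n j), sin (root_angle n j)).

Lemma unit_circle_root n j : unit_circle (root_point n j).
Proof.
have h : cnorm (cplx (root_point n j)) ^+ 2 = 1 by rewrite cnorm_sqr cos2Dsin2.
by apply/eqP; rewrite -(@eqrXn2 _ 2)// ?cnorm_ge0// h expr1n.
Qed.

Context (m : nat -> {nonneg R}) (N : nat -> nat).

Definition stage_measure k : {measure set (@plane R) -> \bar R} :=
  mscale (m k) (msum (fun j => \d_(root_point (N k) j)) (N k)).

Definition atomic_measure : set (@plane R) -> \bar R :=
  mseries stage_measure 0.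

HB.instance Definition _ := Measure.on atomic_measure.

Definition stage_sum (u : @plane R -> R) k : R :=
  (m k)%:num * \sum_(j < N k) u (root_point (N k) j).

Lemma stage_measureE k A : stage_measure k A =
  ((m k)%:num%:E * \sum_(j < N k) \d_(root_point (N k) j) A)%E.
Proof. by []. Qed.

Lemma ge0_integral_stage (u : plane -> R) k :
  (forall w, unit_circle w -> 0 <= u w) -> measurable_fun setT u ->
  (\int[stage_measure k]_(w in unit_circle) (u w)%:E = (stage_sum u k)%:E)%E.
Proof.
move=> u0 mu_; have mU := @measurable_unit_circle R.
have mE : measurable_fun unit_circle (EFin \o u).
  by apply/measurable_EFinP; exact: measurable_funTS.
have u0' w : unit_circle w -> (0 <= (EFin \o u) w)%E.
  by move=> uw; rewrite lee_fin u0.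
rewrite (@ge0_integral_mscale _ _ _ _ _ mU (m k) _ mE u0').
rewrite (@ge0_integral_measure_sum _ _ _ _ _ mU _ u0' mE (N k)).
rewrite /stage_sum EFinM -sumEFin; congr (_ * _)%E; apply: eq_bigr => j _.
rewrite integral_dirac// diracE mem_set ?mul1e//.
exact: unit_circle_root.
Qed.

Lemma ge0_integral_atomic (u : plane -> R) :
  (forall w, unit_circle w -> 0 <= u w) -> measurable_fun setT u ->
  (\int[atomic_measure]_(w in unit_circle) (u w)%:E =
   \sum_(k <oo) (stage_sum u k)%:E)%E.
Proof.
move=> u0 mu_; have mU := @measurable_unit_circle R.
rewrite ge0_integral_measure_series//.
- by apply: eq_eseriesr => k _; exact: ge0_integral_stage.
- by apply/measurable_EFinP; exact: measurable_funTS.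
Qed.

Context (B : R).
Context (mB : forall n, \sum_(k < n) (m k)%:num * (N k)%:R <= B).

Lemma atomic_measure_setT_fin : fin_num_fun atomic_measure.
Proof.
apply: lty_fin_num_fun.
apply: (@le_lt_trans _ _ B%:E); last exact: ltry.
apply: lime_le; first exact: is_cvg_nneseries.
apply: nearW => n; rewrite big_mkord.
apply: le_trans (_ : (\sum_(k < n) (m k)%:num * (N k)%:R)%:E <= _)%E; last first.
  by rewrite lee_fin.
rewrite -sumEFin; apply: lee_sum => k _.
rewrite stage_measureE EFinM lee_wpmul2l ?lee_fin//.
rewrite (eq_bigr (fun=> 1%E)); last by move=> j _; rewrite diracT.
by rewrite sumEFin sumr_const card_ord.
Qed.

Definition finite_atomic : {finite_measure set (@plane R) -> \bar R} :=
  HB.pack atomic_measure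
    (Measure_isFinite.Build _ _ _ atomic_measure atomic_measure_setT_fin).

Local Notation total := (fine (finite_atomic unit_circle)).

Lemma ge0_integral_finite_atomic (u : plane -> R) :
  (forall w, unit_circle w -> 0 <= u w) -> measurable_fun setT u ->
  (\int[finite_atomic]_(w in unit_circle) (u w)%:E =
   \sum_(k <oo) (stage_sum u k)%:E)%E.
Proof. exact: ge0_integral_atomic. Qed.

(** This is the case [u = 1] of the formula for the integral. *)
Lemma sum_masses_le_total n : \sum_(k < n) (m k)%:num * (N k)%:R <= total.
Proof.
have mU := @measurable_unit_circle R.
have h : finite_atomic unit_circle = (\sum_(k <oo) (stage_sum (fun=> 1%R) k)%:E)%E.
  by rewrite -ge0_integral_finite_atomic// integral_cst// mul1e.
rewrite -lee_fin fineK ?fin_num_measure// h.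
apply: le_trans (nneseries_lim_ge n _) => /=.
  rewrite big_mkord -sumEFin; apply: lee_sum => k _.
  by rewrite lee_fin /stage_sum sumr_const card_ord.
move=> k _ _; rewrite lee_fin mulr_ge0// sumr_ge0//.
Qed.

(** Information on the integral is extracted from the partial sums over the
    stages. Adding a constant makes the integrand nonnegative, so that the integral is
    a series with nonnegative terms and the bound passes to the limit. *)
Lemma circle_Rintegral_le (u : plane -> R) (b c : R) (k0 : nat) :
  measurable_fun setT u -> (forall w, unit_circle w -> `|u w| <= b) ->
  (forall n, (k0 <= n)%N -> \sum_(k < n) stage_sum u k <= c) ->
  \int[finite_atomic]_(w in unit_circle) u w <= c.
Proof.
move=> mu_ ub uc.
have mU := @measurable_unit_circle R.
have iu := bounded_circle_integrable finite_atomic mu_ ub.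
have b0 : 0 <= b by exact: le_trans (ub _ (unit_circle_root 1 0)).
have ib : finite_atomic.-integrable unit_circle (EFin \o (fun=> b)).
  apply: (@bounded_circle_integrable _ finite_atomic (fun=> b) b) => //.
  by move=> w _; rewrite ger0_norm.
have ub0 w : unit_circle w -> 0 <= u w + b.
  by move=> /ub; rewrite ler_norml => /andP[+ _]; rewrite -subr_ge0 opprK.
have mub : measurable_fun setT (fun w => u w + b) by exact: measurable_funD.
have iub : finite_atomic.-integrable unit_circle (EFin \o (fun w => u w + b)).
  apply: (@bounded_circle_integrable _ finite_atomic _ (b + b)) => // w /ub uw.
  by rewrite (le_trans (ler_normD _ _))// lerD// ger0_norm.
rewrite -(lerD2r (b * total)) -Rintegral_cst// -RintegralD// Rintegral_cst//.
rewrite /Rintegral ge0_integral_finite_atomic//.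
have s0 k : (0 <= (stage_sum (fun w => (u w + b)%R) k)%:E)%E.
  rewrite lee_fin mulr_ge0// sumr_ge0// => j _; apply: ub0.
  exact: unit_circle_root.
rewrite -lee_fin fineK; last first.
  rewrite -ge0_integral_finite_atomic//.
  exact: (integrable_fin_num mU iub).
apply: lime_le; first exact: is_cvg_nneseries.
exists k0 => // n /= kn; rewrite big_mkord sumEFin lee_fin.
have -> : \sum_(k < n) stage_sum (fun w => u w + b) k =
    \sum_(k < n) stage_sum u k + b * \sum_(k < n) (m k)%:num * (N k)%:R.
  rewrite mulr_sumr -big_split/=; apply: eq_bigr => k _.
  by rewrite /stage_sum big_split/= sumr_const card_ord -mulr_natr; ring.
by rewrite lerD ?uc// ler_wpM2l// sum_masses_le_total.
Qed.

End AtomicMeasure.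

(** * Sums over roots of unity *)

Section RootsOfUnity.
Context {R : realType}.
Implicit Types (z : R[i]) (n : nat).

Definition unity_root n : R[i] := cexp (0 +i* (2 * pi / n%:R)).

Lemma unity_rootX n j : unity_root n ^+ j = cplx (root_point n j).
Proof.
rewrite /unity_root -cexpMn.
have -> : (0 +i* (2 * pi / n%:R)) *+ j = 0 +i* (root_angle n j : R).
  elim: j => [|j IHj]; first by rewrite mulr0n /root_angle mulr0 mul0r.
  rewrite mulrS IHj; apply: complex_ext; rewrite ?cReD ?cImD/= ?addr0//.
  by rewrite /root_angle -natr1; ring.
by apply: complex_ext; rewrite /cexp ?cReM ?cImM/= expR0; ring.
Qed.

Lemma unity_rootX_order n : (0 < n)%N -> unity_root n ^+ n = 1.
Proof.
move=> n0; rewrite unity_rootX /root_point /root_angle mulfK ?pnatr_eq0 ?lt0n_neq0//.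
by rewrite mulr_natl /cplx/= cos2pi sin2pi.
Qed.

Lemma unity_rootX_neq1 n j : (0 < j < n)%N -> unity_root n ^+ j != 1.
Proof.
move=> /andP[j0 jn]; apply/eqP; rewrite unity_rootX => /(congr1 (@complex.Re R)) /= h.
have := cosB1_half (root_angle n j : R).
rewrite h subrr => /esym/eqP; rewrite mulf_eq0 pnatr_eq0/= expf_eq0/=.
have n0 : (0 : R) < n%:R by rewrite ltr0n (leq_trans _ jn).
suff /lt0r_neq0/negPf -> : 0 < sin (root_angle n j / 2 : R) by [].
have -> : root_angle n j / 2 = pi * (j%:R / n%:R) :> R by rewrite /root_angle; field; lra.
have q0 : 0 < j%:R / n%:R :> R by rewrite divr_gt0// ltr0n.
have q1 : j%:R / n%:R < 1 :> R by rewrite ltr_pdivrMr// mul1r ltr_nat.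
by apply: sin_gt0_pi; rewrite mulr_gt0 ?pi_gt0//= gtr_pMr ?pi_gt0.
Qed.

Lemma unity_root_primitive n : (0 < n)%N -> n.-primitive_root (unity_root n).
Proof.
move=> n0; apply/andP; split=> //; apply/forallP => i; rewrite unity_rootE.
have [->|ne] := eqVneq i.+1 n; first by rewrite unity_rootX_order// eqxx.
have lt : (0 < i.+1 < n)%N by rewrite /= ltn_neqAle ne ltn_ord.
by rewrite (negPf (unity_rootX_neq1 lt)).
Qed.

(** When [n] does not divide [l] the sum is a geometric one, with ratio different
    from [1] and [n]-th power equal to [1]. *)
Lemma unity_rootX_sum n l : (0 < n)%N ->
  \sum_(j < n) cplx (root_point n j) ^+ l = if (n %| l)%N then n%:R else 0 :> R[i].
Proof.
move=> n0; have prim := unity_root_primitive n0.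
under eq_bigr do rewrite -unity_rootX -exprM mulnC exprM.
case: ifPn => ndvd.
  have -> : unity_root n ^+ l = 1.
    by apply/eqP; rewrite -(prim_order_dvd prim).
  by under eq_bigr do rewrite expr1n; rewrite sumr_const card_ord.
have ne : unity_root n ^+ l - 1 != 0 by rewrite subr_eq0 -(prim_order_dvd prim).
apply: (mulfI ne); rewrite mulr0 -subrX1 -exprM mulnC exprM.
by rewrite unity_rootX_order// expr1n subrr.
Qed.

Lemma root_pointX n j : (0 < n)%N -> cplx (root_point n j) ^+ n = 1 :> R[i].
Proof. by move=> n0; rewrite -unity_rootX exprAC unity_rootX_order// expr1n. Qed.

Lemma unity_root_sub_neq0 z n j : (0 < n)%N -> z ^+ n != 1 ->
  cplx (root_point n j) - z != 0.
Proof.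
by move=> n0; apply: contra; rewrite subr_eq0 => /eqP <-; rewrite root_pointX.
Qed.

(** Factor [zeta ^ n - z ^ n], where [zeta ^ n = 1]. This turns sums of powers of
    the Cauchy kernel over the roots of unity into power sums. *)
Lemma inv_root_sub z n j : (0 < n)%N -> z ^+ n != 1 ->
  (cplx (root_point n j) - z)^-1 =
  (\sum_(i < n) cplx (root_point n j) ^+ (n.-1 - i) * z ^+ i) / (1 - z ^+ n).
Proof.
move=> n0 zn; have h := unity_root_sub_neq0 j n0 zn.
have h1 : 1 - z ^+ n != 0 by rewrite subr_eq0 eq_sym.
apply: (mulfI h); rewrite mulfV// mulrA -subrXX root_pointX// divff//.
Qed.

(** Only the power [zeta ^ n] survives the summation over the roots. *)
Lemma sum_root_cauchy z n : (0 < n)%N -> z ^+ n != 1 ->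
  \sum_(j < n) cplx (root_point n j) / (cplx (root_point n j) - z) =
  n%:R / (1 - z ^+ n).
Proof.
move=> n0 zn.
under eq_bigr do rewrite inv_root_sub// mulrA.
rewrite -mulr_suml; congr (_ / _).
transitivity (\sum_(i < n) z ^+ i * \sum_(j < n) cplx (root_point n j) ^+ (n - i)).
  under eq_bigr do rewrite mulr_sumr.
  rewrite exchange_big; apply: eq_bigr => i _ /=.
  rewrite mulr_sumr; apply: eq_bigr => j _.
  have -> : (n - i = (n.-1 - i).+1)%N by have := ltn_ord i; lia.
  by rewrite exprS; ring.
rewrite (bigD1 (Ordinal n0))//= expr0 mul1r subn0 unity_rootX_sum// dvdnn.
rewrite big1 ?addr0// => i; rewrite -val_eqE/= => i0.
rewrite unity_rootX_sum// ifF ?mulr0//; apply/negP => /dvdn_leq.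
by have := ltn_ord i; lia.
Qed.

(** In the expanded square the exponents of [zeta] range from [1] to [2 n - 1];
    only the [n] terms of exponent exactly [n] survive the summation. *)
Lemma sum_root_cauchy_sqr z n : (0 < n)%N -> z ^+ n != 1 ->
  \sum_(j < n) cplx (root_point n j) / (cplx (root_point n j) - z) ^+ 2 =
  n%:R ^+ 2 * z ^+ n.-1 / (1 - z ^+ n) ^+ 2.
Proof.
move=> n0 zn.
under eq_bigr do rewrite -exprVn inv_root_sub// exprMn mulrA.
rewrite -mulr_suml -exprVn; congr (_ * _).
transitivity (\sum_(i < n) \sum_(k < n) z ^+ (i + k) *
  \sum_(j < n) cplx (root_point n j) ^+ ((n.-1 - i) + (n.-1 - k)).+1 : R[i]).
  under eq_bigr do rewrite expr2 big_distrlr/= mulr_sumr.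
  rewrite exchange_big; apply: eq_bigr => i _ /=.
  under eq_bigr do rewrite mulr_sumr.
  rewrite exchange_big; apply: eq_bigr => k _ /=.
  rewrite mulr_sumr; apply: eq_bigr => j _.
  by rewrite exprS !exprD; ring.
rewrite (eq_bigr (fun=> n%:R * z ^+ n.-1)); last first.
  move=> i _; have hi := ltn_ord i; rewrite (bigD1 (rev_ord i))//=.
  rewrite [X in _ + X]big1 ?addr0 => [|k]; last first.
    rewrite -val_eqE/= => ki; rewrite unity_rootX_sum// ifF ?mulr0//.
    have hk := ltn_ord k.
    apply/negP => /dvdnP[q hq].
    have : (q = 1)%N.
      case: q hq => [|[|q]] hq //.
      have : (2 * n <= q.+2 * n)%N by apply: leq_mul.
      by lia.
    by move=> q1; rewrite q1 mul1n in hq; lia.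
  rewrite unity_rootX_sum//.
  have -> : ((n.-1 - i + (n.-1 - (n - i.+1))).+1 = n)%N by lia.
  by rewrite dvdnn mulrC; congr (_ * _ ^+ _); lia.
by rewrite sumr_const card_ord -mulr_natl; ring.
Qed.

Lemma sum_root_herglotz z n : (0 < n)%N -> z ^+ n != 1 ->
  \sum_(j < n) herglotz z (root_point n j) =
  n%:R * ((1 + z ^+ n) / (1 - z ^+ n)).
Proof.
move=> n0 zn.
have h1 : 1 - z ^+ n != 0 by rewrite subr_eq0 eq_sym.
transitivity (2%:R * (\sum_(j < n) cplx (root_point n j) / (cplx (root_point n j) - z))
   - n%:R).
  rewrite mulr_sumr -[X in _ - X%:R]card_ord -sumr_const -sumrB.
  apply: eq_bigr => j _; have := unity_root_sub_neq0 j n0 zn.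
  by rewrite /herglotz => h; field.
by rewrite sum_root_cauchy//; field.
Qed.

Lemma sum_root_herglotz_deriv z n : (0 < n)%N -> z ^+ n != 1 ->
  \sum_(j < n) herglotz_deriv z (root_point n j) =
  2%:R * n%:R ^+ 2 * z ^+ n.-1 / (1 - z ^+ n) ^+ 2.
Proof.
move=> n0 zn.
transitivity (2%:R * (\sum_(j < n) cplx (root_point n j) / (cplx (root_point n j) - z) ^+ 2)).
  by rewrite mulr_sumr; apply: eq_bigr => j _; rewrite /herglotz_deriv mulrA.
by rewrite sum_root_cauchy_sqr// !mulrA.
Qed.

End RootsOfUnity.

(** * Herglotz integrals of atomic measures *)

Section HerglotzAtomic.
Context {R : realType} (m : nat -> {nonneg R}) (N : nat -> nat) (B : R).
Context (N0 : forall k, (0 < N k)%N).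
Context (mB : forall n, \sum_(k < n) (m k)%:num * (N k)%:R <= B).
Implicit Types (z : R[i]) (k n : nat).

Local Notation mu := (finite_atomic mB).

(** The contributions of stage [k] to the real part of the Herglotz integral and
    to its derivative, in the closed form obtained by summing over roots of
    unity. *)
Definition stage_poisson k z : R :=
  (m k)%:num * (N k)%:R * ((1 - cnorm z ^+ (2 * N k)) / cnorm (1 - z ^+ N k) ^+ 2).

Definition stage_deriv k z : R[i] :=
  ((m k)%:num)%:C * (2%:R * (N k)%:R ^+ 2 * z ^+ (N k).-1 / (1 - z ^+ N k) ^+ 2).

(** The Cayley transform maps the disk to the right half-plane. *)
Lemma Re_cayley (w : R[i]) : w != 1 ->
  Re ((1 + w) / (1 - w)) = (1 - cnorm w ^+ 2) / cnorm (1 - w) ^+ 2.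
Proof.
move=> w1; rewrite cReM cReV cImV !cReD !cImD !cReN !cImN !cnorm_sqr/=.
rewrite !cReD !cImD !cReN !cImN/=; rewrite mulrA mulrA -mulrBl.
by congr (_ / _); ring.
Qed.

Lemma expc_neq1 z n : (0 < n)%N -> cnorm z < 1 -> z ^+ n != 1.
Proof.
move=> n0 z1; apply/eqP => /(congr1 cnorm); rewrite cnormX cnorm1 => h.
have : cnorm z ^+ n < 1 by rewrite exprn_ilt1 ?cnorm_ge0// -lt0n.
by rewrite h ltxx.
Qed.

Lemma stage_sum_herglotz k z : cnorm z < 1 ->
  stage_sum m N (fun w => Re (herglotz z w)) k = stage_poisson k z.
Proof.
move=> z1; have zn := expc_neq1 (N0 k) z1.
rewrite /stage_sum -cRe_sum sum_root_herglotz// /stage_poisson.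
rewrite -(rmorph_nat (real_complex R)) cReMr mulrA Re_cayley//.
by rewrite cnormX -exprM mulnC.
Qed.

Lemma stage_sum_Re_deriv k z : cnorm z < 1 ->
  stage_sum m N (fun w => Re (herglotz_deriv z w)) k = Re (stage_deriv k z).
Proof.
move=> z1; have zn := expc_neq1 (N0 k) z1.
by rewrite /stage_sum -cRe_sum sum_root_herglotz_deriv// /stage_deriv cReMr.
Qed.

Lemma stage_sum_Im_deriv k z : cnorm z < 1 ->
  stage_sum m N (fun w => Im (herglotz_deriv z w)) k = Im (stage_deriv k z).
Proof.
move=> z1; have zn := expc_neq1 (N0 k) z1.
by rewrite /stage_sum -cIm_sum sum_root_herglotz_deriv// /stage_deriv cImMr.
Qed.

Lemma Re_herglotz_int_le z c : cnorm z < 1 ->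
  (forall n, \sum_(k < n) stage_poisson k z <= c) ->
  Re (herglotz_int mu z) <= c.
Proof.
move=> z1 hc; have [mR _] := cmeasurable_herglotz z.
apply: (@circle_Rintegral_le _ m N B mB _ (2 / (1 - cnorm z)) c 0 mR).
  move=> w /(circle_bounded_herglotz z1); apply: le_trans.
  exact: le_Re_cnorm.
move=> n _; apply: le_trans (hc n); apply: ler_sum => k _.
by rewrite stage_sum_herglotz.
Qed.

(** A tail bound on the stages, applied to the four functions [Re], [- Re],
    [Im] and [- Im], controls the error made by truncating the series. *)
Lemma herglotz_int_deriv_approx z k0 c : cnorm z < 1 ->
  (forall n, \sum_(k0 <= k < n) cnorm (stage_deriv k z) <= c) ->
  cnorm (herglotz_int_deriv mu z - \sum_(k < k0) stage_deriv k z) <= 2 * c.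
Proof.
move=> z1 hc; have [mR mI] := cmeasurable_herglotz_deriv z.
have bd := circle_bounded_herglotz_deriv z1.
set D := \sum_(k < k0) stage_deriv k z.
have key (u : plane -> R) (v : R[i] -> R) : measurable_fun setT u ->
    (forall w, `|u w| <= cnorm (herglotz_deriv z w)) ->
    (forall k, stage_sum m N u k = v (stage_deriv k z)) ->
    (forall w, v w <= cnorm w) ->
    \int[mu]_(w in unit_circle) u w <= \sum_(k < k0) v (stage_deriv k z) + c.
  move=> mu_ ub uv vb.
  apply: (@circle_Rintegral_le _ m N B mB _ (2 / (1 - cnorm z) ^+ 2) _ k0) => //.
    by move=> w /bd; exact: le_trans (ub w).
  move=> n k0n; rewrite (eq_bigr (fun k : 'I_n => v (stage_deriv k z))) => [|k _]; last exact: uv.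
  rewrite -(big_mkord xpredT (fun k => v (stage_deriv k z))).
  rewrite (big_cat_nat (leq0n _) k0n)//= big_mkord lerD2l.
  by apply: le_trans (hc n); apply: ler_sum => k _; exact: vb.
have leRe (w : R[i]) := le_trans (ler_norm _) (le_Re_cnorm w).
have leIm (w : R[i]) := le_trans (ler_norm _) (le_Im_cnorm w).
have leRen (w : R[i]) : - complex.Re w <= cnorm w.
  by rewrite (le_trans (ler_norm _))// normrN le_Re_cnorm.
have leImn (w : R[i]) : - complex.Im w <= cnorm w.
  by rewrite (le_trans (ler_norm _))// normrN le_Im_cnorm.
have sN (u : plane -> R) k : stage_sum m N (fun w => - u w) k = - stage_sum m N u k.
  by rewrite /stage_sum sumrN mulrN.
have iN (u : plane -> R) : measurable_fun setT u ->
    (forall w, `|u w| <= cnorm (herglotz_deriv z w)) ->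
    \int[mu]_(w in unit_circle) (- u w) = - \int[mu]_(w in unit_circle) u w.
  move=> mu_ ub; under eq_Rintegral do rewrite -mulN1r.
  rewrite RintegralZl ?mulN1r//; first exact: measurable_unit_circle.
  apply: (@bounded_circle_integrable _ mu _ (2 / (1 - cnorm z) ^+ 2)) => //.
  by move=> w /bd; exact: le_trans (ub w).
have uR w : `|Re (herglotz_deriv z w)| <= cnorm (herglotz_deriv z w).
  exact: le_Re_cnorm.
have uI w : `|Im (herglotz_deriv z w)| <= cnorm (herglotz_deriv z w).
  exact: le_Im_cnorm.
apply: (le_trans (le_cnorm_ReIm _)); rewrite mulr2n mulrDl mul1r.
rewrite cReD cImD cReN cImN /D cRe_sum cIm_sum /=; apply: lerD.
  rewrite ler_norml lerBlDl (key _ (@complex.Re R))//; last first.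
    by move=> k; rewrite stage_sum_Re_deriv.
  have := key (fun w => - Re (herglotz_deriv z w)) (fun w => - Re w).
  rewrite iN// sumrN andbT => K.
  rewrite -subr_ge0; move: K; rewrite -subr_ge0 => K.
  apply: le_trans (K _ _ _ _) _ => //.
  - exact: measurable_funN.
  - by move=> w; rewrite normrN.
  - by move=> k; rewrite sN stage_sum_Re_deriv.
  - by rewrite le_eqVlt; apply/orP; left; apply/eqP; ring.
rewrite ler_norml lerBlDl (key _ (@complex.Im R))//; last first.
  by move=> k; rewrite stage_sum_Im_deriv.
have := key (fun w => - Im (herglotz_deriv z w)) (fun w => - Im w).
rewrite iN// sumrN andbT => K.
rewrite -subr_ge0; move: K; rewrite -subr_ge0 => K.
apply: le_trans (K _ _ _ _) _ => //.
- exact: measurable_funN.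
- by move=> w; rewrite normrN.
- by move=> k; rewrite sN stage_sum_Im_deriv.
- by rewrite le_eqVlt; apply/orP; left; apply/eqP; ring.
Qed.

End HerglotzAtomic.

(** * Elementary inequalities *)

Section ElementaryBounds.
Context {R : realType}.
Implicit Types (x t : R).

Lemma bernoulli_le x n : -1 <= x -> 1 + n%:R * x <= (1 + x) ^+ n.
Proof.
move=> x1; elim: n => [|n IHn]; first by rewrite mul0r addr0 expr0.
rewrite exprS; apply: (@le_trans _ _ ((1 + x) * (1 + n%:R * x))).
  rewrite -natr1; have : 0 <= n%:R * x ^+ 2 by rewrite mulr_ge0 ?sqr_ge0.
  by move: (n%:R : R) => c; nra.
by rewrite ler_wpM2l// -lerBlDl sub0r.
Qed.

(** Multiply by Bernoulli's bound [1 + n x <= (1 + x) ^ n]: the product is at most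
    [(1 - x ^ 2) ^ n]. It shows how fast [|z| ^ n] decays. *)
Lemma expr1B_mul_le1 x n : 0 <= x <= 1 -> (1 - x) ^+ n * (1 + n%:R * x) <= 1.
Proof.
move=> /andP[x0 x1].
apply: (@le_trans _ _ ((1 - x) ^+ n * (1 + x) ^+ n)).
  by rewrite ler_wpM2l ?exprn_ge0 ?subr_ge0// bernoulli_le//; lra.
by rewrite -exprMn exprn_ile1//; nra.
Qed.

Lemma polarX r t n : (r%:C * cexp (0 +i* t)) ^+ n =
  (r ^+ n)%:C * cexp (0 +i* (n%:R * t)) :> R[i].
Proof.
rewrite exprMn -rmorphXn/= -cexpMn; congr (_ * cexp _).
elim: n => [|n IHn]; first by rewrite mulr0n mul0r.
by rewrite mulrS IHn; apply: complex_ext; rewrite ?cReD ?cImD/= ?addr0// -natr1; ring.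
Qed.

Lemma cnorm_polar r t : 0 <= r -> cnorm (r%:C * cexp (0 +i* t)) = r :> R.
Proof. by move=> r0; rewrite cnormM cnormR cnorm_cexp/= expR0 mulr1 ger0_norm. Qed.

(** The distance from [1] to the line through the origin in the direction [t]
    is [|sin t|]. *)
Lemma abs_sin_le_cnorm_1B r t : `|sin t| <= cnorm (1 - r%:C * cexp (0 +i* t)).
Proof.
rewrite -ler_sqr ?nnegrE ?cnorm_ge0// real_normK ?num_real//.
rewrite cnorm_sqr !(cReD, cImD, cReN, cImN, cReM, cImM)/= expR0 -subr_ge0.
have h := cos2Dsin2 t.
set c := cos t in h *; set s := sin t in h *.
rewrite (_ : _ - _ = (r - c) ^+ 2 + (1 - (c ^+ 2 + s ^+ 2)) * (1 - r ^+ 2)).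
  by rewrite h subrr mul0r addr0 sqr_ge0.
by ring.
Qed.

Lemma half_le_sin t : 0 <= t <= 2^-1 -> t / 2 <= sin t.
Proof.
move=> /andP[t0 t1]; have := sin_sub_le t; rewrite ler_norml => /andP[h _].
by nra.
Qed.

Lemma le_sin_pihalf s t : 0 <= s -> s <= t -> t <= pi / 2 -> sin s <= sin t.
Proof.
move=> s0 st tp; rewrite leNgt ltr_sin ?in_itv/= -?leNgt//; apply/andP; split=> //.
- by rewrite (le_trans _ (le_trans s0 st))// oppr_le0 divr_ge0 ?pi_ge0.
- by rewrite (le_trans _ s0)// oppr_le0 divr_ge0 ?pi_ge0.
- exact: le_trans tp.
Qed.

End ElementaryBounds.

(** * Lacunary scales *)

Section LacunaryScales.
Context {R : realType} (a b : nat).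
Context (a14 : (14 <= a)%N) (ab : (a.+2 <= b)%N).

(** The scales [x_k] grow doubly exponentially, so that every power of [x_k] that
    appears is negligible against [x_(k+1) = N_k]. Stage [k] has [N_k] atoms of
    mass [x_k ^ a / N_k ^ 2]. *)
Fixpoint scale (k : nat) : nat := if k is k'.+1 then (scale k' ^ b)%N else 2.

Definition order k := scale k.+1.

Local Notation X k := ((scale k)%:R : R).

Definition mass k : {nonneg R} := (X k ^+ a / (order k)%:R ^+ 2)%:nng.

Lemma scale_ge2 k : (2 <= scale k)%N.
Proof.
elim: k => [//|k IHk] /=; rewrite (leq_trans IHk)//.
rewrite -[leqLHS]expn1 leq_exp2l//; lia.
Qed.

Lemma leq_scaleS k : (scale k <= scale k.+1)%N.
Proof.
by rewrite /= -[leqLHS]expn1 leq_exp2l ?(leq_trans _ (scale_ge2 k))//; lia.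
Qed.

Lemma leq_scale : {homo scale : i j / (i <= j)%N}.
Proof. by apply: homo_leq => // [i j k|]; [exact: leq_trans|exact: leq_scaleS]. Qed.

Lemma expn_leq_scale k : (2 ^ k.+1 <= scale k)%N.
Proof.
elim: k => [//|k IHk] /=; rewrite expnS.
apply: (@leq_trans (scale k ^ 2)).
  by rewrite -mulnn; apply: leq_mul => //; exact: scale_ge2.
by rewrite leq_exp2l ?scale_ge2//; lia.
Qed.

Lemma ltn_scale k : (k < scale k)%N.
Proof. by rewrite (leq_trans _ (expn_leq_scale k))// ltnW// ltn_expl. Qed.

Lemma scale_gt0 k : 0 < X k.
Proof. by rewrite ltr0n (leq_trans _ (scale_ge2 k)). Qed.

Lemma scale_ge1 k : 1 <= X k.
Proof. by rewrite ler1n (leq_trans _ (scale_ge2 k)). Qed.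

Lemma order_gt0 k : (0 < order k)%N.
Proof. by rewrite (leq_trans _ (scale_ge2 k.+1)). Qed.

Lemma orderE k : (order k)%:R = X k ^+ b :> R.
Proof. by rewrite /order /= natrX. Qed.

Lemma geometric_half_sum n : \sum_(k < n) (2^-1 : R) ^+ k.+1 <= 1.
Proof.
have -> : \sum_(k < n) (2^-1 : R) ^+ k.+1 = 1 - 2^-1 ^+ n.
  elim: n => [|n IHn]; first by rewrite big_ord0 expr0 subrr.
  by rewrite big_ord_recr/= IHn exprS; field.
by rewrite gerBl exprn_ge0.
Qed.

Lemma scaleV_le k : (X k)^-1 <= 2^-1 ^+ k.+1.
Proof.
rewrite exprVn lef_pV2 ?posrE ?scale_gt0 ?exprn_gt0//.
by rewrite -natrX ler_nat expn_leq_scale.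
Qed.

Lemma sum_scaleV_le n : \sum_(k < n) (X k)^-1 <= 1.
Proof.
by apply: le_trans (geometric_half_sum n); apply: ler_sum => k _; exact: scaleV_le.
Qed.

Lemma scale_exp_le i j c k : (i + c <= j)%N -> 2 ^+ c * X k ^+ i <= X k ^+ j :> R.
Proof.
move=> ij; apply: (@le_trans _ _ (X k ^+ c * X k ^+ i)).
  rewrite ler_wpM2r ?exprn_ge0 ?(ltW (scale_gt0 k))//.
  by rewrite lerXn2r ?nnegrE// ?(ltW (scale_gt0 k))// ler_nat scale_ge2.
by rewrite -exprD ler_weXn2l ?scale_ge1//; lia.
Qed.

Lemma massM_orderE k : (mass k)%:num * (order k)%:R = X k ^+ a / X k ^+ b.
Proof.
rewrite /= orderE; have := scale_gt0 k; set y := X k => y0.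
by field; apply: lt0r_neq0; rewrite ?exprn_gt0.
Qed.

Lemma massM_order_le k : (mass k)%:num * (order k)%:R <= (X k)^-1.
Proof.
rewrite massM_orderE ler_pdivrMr ?exprn_gt0 ?scale_gt0//.
rewrite ler_pdivlMl ?scale_gt0// -exprS.
by have := @scale_exp_le a.+1 b 0 k; rewrite expr0 mul1r => -> //; lia.
Qed.

Lemma sum_massM_order_le n : \sum_(k < n) (mass k)%:num * (order k)%:R <= 1.
Proof.
by apply: le_trans (sum_scaleV_le n); apply: ler_sum => k _; exact: massM_order_le.
Qed.

End LacunaryScales.

(** * Growth of the derivative on the circles *)

Lemma sum_if_lt (V : pzRingType) (c : V) n k :
  \sum_(j < n) (if (j < k)%N then c else 0) = (minn n k)%:R * c.
Proof.
elim: n => [|n IHn]; first by rewrite big_ord0 min0n mul0r.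
rewrite big_ord_recr/= IHn; case: ltnP => nk.
  by rewrite (minn_idPl nk) -natr1 mulrDl mul1r.
by rewrite (minn_idPr (leqW nk)) addr0.
Qed.

Section LowerBound.
Context {R : realType} (a b : nat).
Context (a14 : (14 <= a)%N) (ab : (a.+2 <= b)%N).

Local Notation X k := ((scale b k)%:R : R).
Local Notation N := (order b).
Local Notation m := (mass (R := R) a b).
Local Notation mu := (finite_atomic (sum_massM_order_le (R := R) a14 ab)).

Lemma cnorm_stage_deriv j (z : R[i]) : cnorm (stage_deriv m N j z) =
  2 * X j ^+ a * (cnorm z ^+ (N j).-1 / cnorm (1 - z ^+ N j) ^+ 2).
Proof.
rewrite /stage_deriv cnormM cnormR cnormM cnormV (cnormM (2%:R * _)) (cnormM 2%:R).
rewrite !cnormX !cnormn ger0_norm//.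
have -> : (m j)%:num = X j ^+ a / (N j)%:R ^+ 2 by [].
have n0 : ((N j)%:R : R) != 0 by rewrite pnatr_eq0 -lt0n (order_gt0 a14 ab).
set P := cnorm z ^+ _; set Q := (cnorm (1 - _) ^+ 2)^-1; set y := X j ^+ a.
move: n0; set n := (N j)%:R => n0.
by field.
Qed.

(** At this radius [r ^ N_k] is bounded above and below away from [1] and [0]:
    stage [k] is large and the later stages have hardly started. *)
Definition radius k : R := 1 - ((N k)%:R)^-1.

Definition circle_pt k (t : R) : R[i] := (radius k)%:C * cexp (0 +i* t).

Lemma order_inv_le_half k : ((N k)%:R : R)^-1 <= 2^-1.
Proof. by rewrite lef_pV2 ?posrE ?ltr0n ?(order_gt0 a14 ab)// ler_nat (scale_ge2 a14 ab k.+1). Qed.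

Lemma order_inv_le1 k : ((N k)%:R : R)^-1 <= 1.
Proof. by have := order_inv_le_half k; lra. Qed.

Lemma order_inv_ge0 k : 0 <= ((N k)%:R : R)^-1.
Proof. by rewrite invr_ge0. Qed.

Lemma radius_bounds k : 2^-1 <= radius k < 1.
Proof.
have := order_inv_le_half k.
have : 0 < ((N k)%:R : R)^-1 by rewrite invr_gt0 ltr0n (order_gt0 a14 ab).
by rewrite /radius; lra.
Qed.

Lemma cnorm_circle_pt k t : cnorm (circle_pt k t) = radius k.
Proof. by rewrite cnorm_polar//; have := radius_bounds k; lra. Qed.

Lemma radiusX_le k j : (k <= j)%N ->
  radius k ^+ N j <= (N k)%:R / (N j)%:R /\ radius k ^+ N j <= 2^-1.
Proof.
move=> kj.
have Nk0 : 0 < ((N k)%:R : R) by rewrite ltr0n (order_gt0 a14 ab).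
have Nj0 : 0 < ((N j)%:R : R) by rewrite ltr0n (order_gt0 a14 ab).
have h : ((N k)%:R : R) <= (N j)%:R by rewrite ler_nat; apply: (leq_scale a14 ab).
have := @expr1B_mul_le1 R (N k)%:R^-1 (N j).
rewrite -/(radius k) => /(_ _) H.
have {}H : radius k ^+ N j * (1 + (N j)%:R / (N k)%:R) <= 1.
  by apply: H; rewrite order_inv_ge0 (le_trans (order_inv_le_half k))//; lra.
have q1 : 1 <= (N j)%:R / (N k)%:R :> R by rewrite ler_pdivlMr// mul1r.
have r0 : 0 <= radius k ^+ N j by rewrite exprn_ge0//; have := radius_bounds k; lra.
split.
  rewrite -[leRHS]invf_div -[leRHS]mul1r ler_pdivlMr ?divr_gt0//.
  by apply: le_trans H; rewrite ler_wpM2l//; lra.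
by nra.
Qed.

(** As [N_k = 2 h] is even, [r ^ N_k] is the square of [r ^ h], and [r ^ h >= 1/2]
    by Bernoulli's inequality. *)
Lemma radiusX_ge k : 4^-1 <= radius k ^+ N k.
Proof.
have /dvdnP[h hE] : (2 %| N k)%N.
  have b0 : (0 < b)%N by exact: leq_trans ab.
  by rewrite /order; elim: (k.+1) => [//|i IHi]; exact: dvdn_exp.
have h0 : (0 < h)%N by have := order_gt0 a14 ab k; rewrite hE; lia.
have : 2^-1 <= radius k ^+ h.
  have := @bernoulli_le R (- (N k)%:R^-1) h.
  rewrite lerN2 order_inv_le1 => /(_ isT).
  apply: le_trans; rewrite hE natrM.
  rewrite le_eqVlt; apply/orP; left; apply/eqP; field.
  by rewrite pnatr_eq0 -lt0n.
move=> r2; rewrite hE exprM expr2.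
have -> : (4^-1 : R) = 2^-1 * 2^-1 by field.
by apply: ler_pM.
Qed.

Section OnArc.
Context (k : nat) (t : R).
Context (t1 : pi / (4 * X k) <= t) (t2 : t <= pi / (2 * X k)).
Local Notation z := (circle_pt k t).

Lemma cnorm_circle_pt_lt1 : cnorm z < 1.
Proof. by rewrite cnorm_circle_pt; have := radius_bounds k; lra. Qed.

(** For an earlier stage [j] the angle [N_j t] lies between [pi / (4 x_k)] and
    [pi / 2], because [1 <= N_j <= x_k]; its sine is bounded below there. *)
Lemma early_dist_ge j : (j < k)%N -> (4 * X k)^-1 <= cnorm (1 - z ^+ N j).
Proof.
move=> jk; rewrite /circle_pt polarX; apply: le_trans (abs_sin_le_cnorm_1B _ _).
apply: le_trans (ler_norm _).
have Xk := scale_gt0 (R := R) a14 ab k.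
have Xk2 : 2 <= X k by rewrite ler_nat (scale_ge2 a14 ab).
have N1 : 1 <= ((N j)%:R : R) by rewrite ler1n (order_gt0 a14 ab).
have NX : ((N j)%:R : R) <= X k by rewrite ler_nat; apply: (leq_scale a14 ab).
have p0 := @pi_ge2 R.
have p4 : (pi : R) < 4 by have := @pihalf_lt2 R; lra.
pose y := pi / (4 * X k); have t1' : y <= t := t1.
have y0 : 0 < y by rewrite divr_gt0// ?mulr_gt0//; lra.
have y1 : y <= 2^-1.
  by rewrite /y ler_pdivrMr ?mulr_gt0//; nra.
have s1 : (4 * X k)^-1 <= y / 2.
  rewrite /y -[leLHS]mul1r mulrAC ler_wpM2r ?invr_ge0 ?mulr_ge0 ?(ltW Xk)//; lra.
apply: (le_trans s1); apply: (@le_trans _ _ (sin y)).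
  by apply: half_le_sin; rewrite (ltW y0).
have t0 : 0 < t by exact: lt_le_trans t1'.
apply: le_sin_pihalf; first exact: ltW.
  by apply: (le_trans t1'); rewrite ler_peMl// ltW.
apply: (@le_trans _ _ (X k * (pi / (2 * X k)))).
  by apply: ler_pM => //; rewrite ltW.
rewrite le_eqVlt; apply/orP; left; apply/eqP; field.
exact: lt0r_neq0.
Qed.

Lemma early_scale_le j : (j < k)%N -> X j ^+ a <= X k.
Proof.
move=> jk; apply: (@le_trans _ _ (N j)%:R); last by rewrite ler_nat; apply: (leq_scale a14 ab).
rewrite orderE; have := @scale_exp_le R a b a14 ab a b 0 j.
by rewrite expr0 mul1r => -> //; lia.
Qed.

Lemma early_inv_dist_le j : (j < k)%N ->
  (cnorm (1 - z ^+ N j) ^+ 2)^-1 <= 16 * X k ^+ 2.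
Proof.
move=> jk; have Xk := scale_gt0 (R := R) a14 ab k.
have d := early_dist_ge jk.
have d0 : 0 < (4 * X k)^-1 by rewrite invr_gt0 mulr_gt0.
have -> : 16 * X k ^+ 2 = (((4 * X k)^-1) ^+ 2)^-1.
  by field; exact: lt0r_neq0.
rewrite lef_pV2 ?posrE ?exprn_gt0//; last exact: lt_le_trans d.
by rewrite ler_sqr ?nnegrE ?cnorm_ge0// ltW.
Qed.

(** The circle is so close to the boundary at the scale of the earlier stages that
    their Poisson integrals almost vanish away from the atoms. *)
Lemma early_poisson_le j : (j < k)%N -> stage_poisson m N j z <= (X k)^-1.
Proof.
move=> jk; have Xk := scale_gt0 (R := R) a14 ab k.
have Nk0 : 0 < ((N k)%:R : R) by rewrite ltr0n (order_gt0 a14 ab).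
have Nj0 : 0 < ((N j)%:R : R) by rewrite ltr0n (order_gt0 a14 ab).
rewrite /stage_poisson cnorm_circle_pt.
have e1 : 1 - radius k ^+ (2 * N j) <= 2 * (N j)%:R / (N k)%:R.
  have := @bernoulli_le R (- (N k)%:R^-1) (2 * N j).
  rewrite lerN2 order_inv_le1 => /(_ isT).
  by rewrite natrM /radius; lra.
have -> : (m j)%:num * (N j)%:R = X j ^+ a / (N j)%:R.
  by rewrite massM_orderE// orderE.
have e2 := early_inv_dist_le jk; have e3 := early_scale_le jk.
have e4 : 0 <= 1 - radius k ^+ (2 * N j).
  by rewrite subr_ge0 exprn_ile1//; have := radius_bounds k; lra.
have e5 := scale_exp_le (R := R) a14 ab (i := 4) (j := b) (c := 5) k.
apply: (@le_trans _ _ (X k / (N j)%:R * (2 * (N j)%:R / (N k)%:R * (16 * X k ^+ 2)))).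
  apply: ler_pM; rewrite ?divr_ge0 ?mulr_ge0 ?exprn_ge0 ?invr_ge0 ?cnorm_ge0//.
    by rewrite ler_wpM2r// invr_ge0.
  by apply: ler_pM => //; rewrite invr_ge0 sqr_ge0.
have -> : X k / (N j)%:R * (2 * (N j)%:R / (N k)%:R * (16 * X k ^+ 2)) =
   2 ^+ 5 * X k ^+ 3 / (N k)%:R :> R by field; rewrite !lt0r_neq0.
rewrite ler_pdivrMr// ler_pdivlMl// orderE mulrCA -exprS.
by apply: e5; lia.
Qed.

Lemma late_dist_ge j : (k <= j)%N -> 2^-1 <= cnorm (1 - z ^+ N j).
Proof.
move=> /radiusX_le[_ h]; apply: le_trans (lerB_cnorm _ _).
by rewrite cnorm1 cnormX cnorm_circle_pt; lra.
Qed.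

Lemma late_inv_dist_le j : (k <= j)%N -> (cnorm (1 - z ^+ N j) ^+ 2)^-1 <= 4.
Proof.
move=> /late_dist_ge d.
have -> : 4 = ((2^-1) ^+ 2)^-1 :> R by field.
rewrite lef_pV2 ?posrE ?exprn_gt0//; last exact: lt_le_trans d.
by rewrite ler_sqr ?nnegrE ?cnorm_ge0.
Qed.

Lemma late_poisson_le j : (k <= j)%N ->
  stage_poisson m N j z <= 4 * (X j)^-1.
Proof.
move=> kj; rewrite /stage_poisson cnorm_circle_pt mulrC.
have e2 := late_inv_dist_le kj.
have rr : 0 <= radius k ^+ (2 * N j) <= 1.
  have := radius_bounds k => rb.
  by rewrite exprn_ge0 ?exprn_ile1//; lra.
apply: ler_pM => //.
- by rewrite divr_ge0 ?sqr_ge0//; lra.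
- rewrite -[leRHS]mul1r; apply: ler_pM => //; [lra| |lra].
  by rewrite invr_ge0 sqr_ge0.
- exact: (massM_order_le a14 ab).
Qed.

(** The earlier stages contribute at most [k / x_k <= 1], the other ones at most
    four times their total mass. *)
Lemma Re_herglotz_int_le5 : Re (herglotz_int mu z) <= 5.
Proof.
apply: Re_herglotz_int_le => [j||n]; first exact: (order_gt0 a14 ab).
  exact: cnorm_circle_pt_lt1.
apply: (@le_trans _ _ (\sum_(j < n) ((if (j < k)%N then (X k)^-1 else 0) + 4 * (X j)^-1))).
  apply: ler_sum => j _; case: ltnP => [jk|kj].
    by rewrite ler_wpDr ?early_poisson_le// mulr_ge0// invr_ge0.
  by rewrite add0r late_poisson_le.
rewrite big_split/= -mulr_sumr.
have -> : 5 = 1 + 4 * 1 :> R by field.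
apply: lerD; last by rewrite ler_wpM2l// (sum_scaleV_le a14 ab).
rewrite sum_if_lt ler_pdivrMr ?mul1r; last exact: (scale_gt0 a14 ab).
by rewrite ler_nat (leq_trans (geq_minr _ _))// ltnW// (ltn_scale a14 ab).
Qed.

Lemma early_deriv_le j : (j < k)%N ->
  cnorm (stage_deriv m N j z) <= 32 * X k ^+ 3.
Proof.
move=> jk; have Xk := scale_gt0 (R := R) a14 ab k.
rewrite cnorm_stage_deriv cnorm_circle_pt.
have -> : 32 * X k ^+ 3 = 2 * X k * (1 * (16 * X k ^+ 2)) by ring.
have rb := radius_bounds k.
have r1 : 0 <= radius k ^+ (N j).-1 <= 1.
  by rewrite exprn_ge0 ?exprn_ile1//; lra.
apply: ler_pM.
- by rewrite mulr_ge0// exprn_ge0.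
- by rewrite divr_ge0 ?sqr_ge0//; lra.
- by rewrite ler_wpM2l// early_scale_le.
- apply: ler_pM; rewrite ?invr_ge0 ?sqr_ge0 ?early_inv_dist_le//; lra.
Qed.

Lemma main_deriv_ge : X k ^+ a / 8 <= cnorm (stage_deriv m N k z).
Proof.
have Xk := scale_gt0 (R := R) a14 ab k.
rewrite cnorm_stage_deriv cnorm_circle_pt.
have -> : X k ^+ a / 8 = 2 * X k ^+ a * (4^-1 / 4) by field.
rewrite ler_wpM2l ?mulr_ge0 ?exprn_ge0 ?(ltW Xk)//.
have rb := radius_bounds k.
have d := late_dist_ge (leqnn k).
apply: ler_pM => //.
  apply: (le_trans (radiusX_ge k)).
  have -> : radius k ^+ N k = radius k * radius k ^+ (N k).-1.
    by rewrite -exprS prednK// (order_gt0 a14 ab).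
  by rewrite ler_piMl// ?exprn_ge0//; lra.
rewrite lef_pV2 ?posrE ?exprn_gt0//; last exact: lt_le_trans d.
have -> : 4 = 2 ^+ 2 :> R by ring.
rewrite ler_sqr ?nnegrE ?cnorm_ge0//.
rewrite (le_trans (ler_cnormB _ _))// cnorm1 cnormX cnorm_circle_pt.
by have [_] := radiusX_le (leqnn k); lra.
Qed.

(** The factor [r ^ N_j <= N_k / N_j <= x_j / x_j ^ b] beats [A_j = x_j ^ a]
    because [b >= a + 2]. *)
Lemma late_deriv_le j : (k < j)%N ->
  cnorm (stage_deriv m N j z) <= 16 * (X j)^-1.
Proof.
move=> kj; have Xj := scale_gt0 (R := R) a14 ab j.
have rb := radius_bounds k.
have r0 : 0 < radius k by lra.
have [h _] := radiusX_le (ltnW kj).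
rewrite cnorm_stage_deriv cnorm_circle_pt.
have NX : ((N k)%:R : R) <= X j by rewrite ler_nat; apply: (leq_scale a14 ab).
have rN : radius k ^+ (N j).-1 <= 2 * (X j / X j ^+ b).
  have -> : radius k ^+ (N j).-1 = (radius k)^-1 * radius k ^+ N j.
    have -> : radius k ^+ N j = radius k * radius k ^+ (N j).-1.
      by rewrite -exprS prednK// (order_gt0 a14 ab).
    by rewrite mulKf// lt0r_neq0.
  apply: ler_pM; rewrite ?invr_ge0 ?exprn_ge0 ?(ltW r0)//.
    by rewrite -[leRHS]invrK lef_pV2 ?posrE ?invr_gt0//; lra.
  apply: (le_trans h); rewrite -orderE ler_wpM2r// ?invr_ge0//.
have e4 := scale_exp_le (R := R) a14 ab (i := a.+2) (j := b) (c := 0) j.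
have {}e4 : X j ^+ a.+2 <= X j ^+ b by rewrite -[leLHS]mul1r -[1](expr0 2) e4//; lia.
apply: (@le_trans _ _ (2 * X j ^+ a * (2 * (X j / X j ^+ b) * 4))).
  rewrite ler_wpM2l ?mulr_ge0 ?exprn_ge0 ?(ltW Xj)//.
  apply: ler_pM; rewrite ?exprn_ge0 ?(ltW r0) ?invr_ge0 ?sqr_ge0//.
  by apply: late_inv_dist_le; exact: ltnW.
have -> : 2 * X j ^+ a * (2 * (X j / X j ^+ b) * 4) = 16 * (X j ^+ a.+1 / X j ^+ b).
  by rewrite exprS; field; apply: lt0r_neq0; rewrite exprn_gt0.
rewrite ler_wpM2l// ler_pdivrMr ?exprn_gt0// ler_pdivlMl// -exprS//.
Qed.

(** Stage [k] contributes at least [x_k ^ a / 8]; the earlier stages take away at most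
    [32 x_k ^ 4] and the later ones at most [32], which is at most half of it in
    total since [a >= 14]. *)
Lemma herglotz_int_deriv_ge : X k ^+ a / 16 <= cnorm (herglotz_int_deriv mu z).
Proof.
have Xk := scale_gt0 (R := R) a14 ab k.
have h1 : cnorm (herglotz_int_deriv mu z - \sum_(j < k.+1) stage_deriv m N j z) <= 2 * 16.
  apply: herglotz_int_deriv_approx => [j||n]; first exact: (order_gt0 a14 ab).
    exact: cnorm_circle_pt_lt1.
  apply: (@le_trans _ _ (\sum_(k.+1 <= j < n) 16 * (X j)^-1)).
    by rewrite big_nat_cond [leRHS]big_nat_cond; apply: ler_sum => j /andP[/andP[kj _] _]; exact: late_deriv_le.
  rewrite -mulr_sumr -[leRHS]mulr1 ler_wpM2l//.
  have [kn|nk] := leqP k.+1 n; last by rewrite big_geq// ltnW.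
  apply: le_trans (sum_scaleV_le a14 ab n).
  rewrite -(big_mkord xpredT (fun j => (X j)^-1)) (big_cat_nat (leq0n _) kn)/=.
  by rewrite lerDr sumr_ge0// => j _; rewrite invr_ge0.
have h2 : cnorm (\sum_(j < k) stage_deriv m N j z) <= 32 * X k ^+ 4.
  apply: (le_trans (ler_cnorm_sum _ _ _)).
  apply: (@le_trans _ _ (\sum_(j < k) 32 * X k ^+ 3)).
    by apply: ler_sum => j _; exact: early_deriv_le.
  rewrite sumr_const card_ord -[leLHS]mulr_natl mulrCA ler_wpM2l// [leRHS]exprS ler_wpM2r ?exprn_ge0 ?(ltW Xk)//.
  by rewrite ler_nat ltnW// (ltn_scale a14 ab).
have h3 := main_deriv_ge.
have h4 : 2 ^+ 10 * X k ^+ 4 <= X k ^+ a.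
  by apply: (scale_exp_le a14 ab) => //; lia.
have X4 : 1 <= X k ^+ 4 by rewrite exprn_ege1// (scale_ge1 a14 ab).
move: h1; rewrite [\sum_(j < k.+1) _]big_ord_recr.
set S0 := \sum_(j < k) _ in h2 *; set D := stage_deriv m N k z in h3 *.
set F := herglotz_int_deriv mu z => h1.
have h5 : cnorm D <= cnorm F + cnorm (F - (S0 + D)) + cnorm S0.
  rewrite [leLHS](_ : _ = cnorm ((F - (F - (S0 + D))) - S0)); last by congr cnorm; ring.
  by rewrite (le_trans (ler_cnormB _ _))// lerD2r ler_cnormB.
have p10 : 2 ^+ 10 = 1024 :> R by rewrite -natrX.
rewrite p10 in h4; set y := X k ^+ 4 in h2 h4 X4; set v := X k ^+ a in h3 h4 *.
lra.
Qed.

Lemma cnorm_cderive_ge :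
  expR (- 5) * (X k ^+ a / 16) <= cnorm (cderive (singular_inner mu) z).
Proof.
have [_ ->] := cderive_singular_inner mu cnorm_circle_pt_lt1.
rewrite cnormN cnormM cnorm_singular_inner; apply: ler_pM.
- exact: expR_ge0.
- by rewrite divr_ge0// exprn_ge0.
- by rewrite ler_expR lerN2 Re_herglotz_int_le5.
- exact: herglotz_int_deriv_ge.
Qed.

End OnArc.

End LowerBound.

(** * Divergence of the integral means *)

Section NotHardy.

(** The integral of a nonnegative function is a supremum over the simple
    functions below it, hence monotone on arbitrary functions. *)
Lemma ge0_le_integralT d (T : measurableType d) (R : realType)
    (mu : {measure set T -> \bar R}) (f g : T -> \bar R) :
  (forall x, 0 <= f x)%E -> (forall x, f x <= g x)%E ->
  (\int[mu]_x f x <= \int[mu]_x g x)%E.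
Proof.
move=> f0 fg; have g0 x : (0 <= g x)%E by exact: le_trans (fg x).
rewrite !ge0_integralTE//; apply: ereal_sup_le => _ [h hf <-].
by exists h => // x; exact: le_trans (fg x).
Qed.

Lemma ge0_integral_ge_cst d (T : measurableType d) (R : realType)
    (mu : {measure set T -> \bar R}) (D A : set T) (f : T -> \bar R) (c : R) :
  measurable A -> A `<=` D -> 0 <= c -> (forall x, D x -> 0 <= f x)%E ->
  (forall x, A x -> c%:E <= f x)%E ->
  (c%:E * mu A <= \int[mu]_(x in D) f x)%E.
Proof.
move=> mA AD c0 f0 fc.
rewrite -integral_cst// integral_mkcond [leRHS]integral_mkcond.
have c0' : (0 <= c%:E)%E by rewrite lee_fin.
apply: ge0_le_integralT => x; rewrite !patchE.
  by case: ifPn.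
case: ifPn => [|_]; last by case: ifPn => //; rewrite inE => /f0.
by rewrite inE => Ax; rewrite mem_set ?fc//; exact: AD.
Qed.

Context {R : realType} (p : R) (a b : nat).
Context (p0 : 0 < p) (ap : 2 <= a%:R * p).
Context (a14 : (14 <= a)%N) (ab : (a.+2 <= b)%N).

Local Notation X k := ((scale b k)%:R : R).
Local Notation mu := (finite_atomic (sum_massM_order_le (R := R) a14 ab)).

Definition mean_const : R := 8^-1 * (expR (- 5) / 16) `^ p.

Lemma mean_const_gt0 : 0 < mean_const.
Proof. by rewrite mulr_gt0// powR_gt0// divr_gt0// expR_gt0. Qed.

(** The arc has length [pi / (4 x_k)] and the integrand is there at least a constant
    times [x_k ^ (a p) >= x_k ^ 2]. *)
Lemma integral_mean_ge k :
  ((mean_const * X k)%:E <=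
   integral_mean p (cderive (singular_inner mu)) (radius (R := R) b k))%E.
Proof.
have Xk := scale_gt0 (R := R) a14 ab k.
have X1 := scale_ge1 (R := R) a14 ab k.
have pi0 := @pi_gt0 R.
set c := (expR (- 5) * (X k ^+ a / 16)) `^ p.
have c0 : 0 <= c by exact: powR_ge0.
pose I := `[pi / (4 * X k), pi / (2 * X k)]%classic.
have lem : (c%:E * @lebesgue_measure R I <=
    \int[@lebesgue_measure R]_(t in `[0%R, (2 * pi)%R])
     (cnorm (cderive (singular_inner mu) (circle_pt b k t)) `^ p)%:E)%E.
  apply: ge0_integral_ge_cst => //.
  - exact: measurable_itv.
  - rewrite /I => t /=; rewrite !in_itv/= => /andP[t1 t2]; apply/andP; split.
      by apply: le_trans t1; rewrite divr_ge0 ?mulr_ge0 ?pi_ge0// ltW.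
    apply: (le_trans t2); rewrite ler_pdivrMr ?mulr_gt0//.
    by nra.
  - by move=> t _; rewrite lee_fin powR_ge0.
  - rewrite /I => t /=; rewrite in_itv/= => /andP[t1 t2]; rewrite lee_fin.
    have e0 : 0 <= expR (- 5) * (X k ^+ a / 16).
      by rewrite mulr_ge0 ?expR_ge0// divr_ge0// exprn_ge0.
    have e1 := cnorm_cderive_ge a14 ab t1 t2.
    by apply: ge0_ler_powR; rewrite ?nnegrE ?cnorm_ge0 ?(ltW p0).
rewrite /integral_mean -/(circle_pt b k).
apply: (@le_trans _ _ ((2 * pi)^-1%:E * (c%:E * @lebesgue_measure R I))%E); last first.
  by rewrite lee_wpmul2l// lee_fin invr_ge0 mulr_ge0 ?pi_ge0.
have IE : lebesgue_measure I = (pi / (4 * X k))%:E.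
  rewrite /I lebesgue_measure_itv/= lte_fin ifT.
    by rewrite -EFinD; congr _%:E; field; apply: lt0r_neq0.
  by rewrite ltr_pM2l// ltf_pV2 ?posrE ?mulr_gt0// ltr_pM2r//; lra.
rewrite IE -!EFinM lee_fin.
have -> : (2 * pi)^-1 * (c * (pi / (4 * X k))) = 8^-1 * (c / X k).
  move: pi0 Xk; move: (pi : R) (X k) => q y q0 y0; field; by rewrite !lt0r_neq0.
rewrite /mean_const -mulrA ler_pM2l// ler_pdivlMr//.
have -> : c = (expR (- 5) / 16) `^ p * (X k ^+ a) `^ p.
  rewrite -powRM ?divr_ge0 ?expR_ge0 ?exprn_ge0//.
  by rewrite /c; congr (_ `^ _); rewrite mulrA mulrAC.
rewrite -mulrA ler_wpM2l ?powR_ge0//.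
rewrite -powR_mulrn ?(ltW Xk)// -powRrM -expr2 -powR_mulrn ?(ltW Xk)//.
exact: ler_powR.
Qed.

Lemma not_Hardy_cderive : ~ Hardy p (cderive (singular_inner mu)).
Proof.
move=> [_]; set s := ereal_sup _ => s_fin.
have sk k : ((mean_const * X k)%:E <= s)%E.
  apply: (le_trans (integral_mean_ge k)); apply: ereal_sup_ubound.
  exists (radius b k) => //=; rewrite in_itv/=.
  by have := radius_bounds (R := R) a14 ab k; lra.
have m0 := mean_const_gt0.
have s_num : s \is a fin_num.
  rewrite fin_numE; apply/andP; split; apply/eqP => sE.
    by have := sk 0; rewrite sE leeNy_eq.
  by move: s_fin; rewrite sE.
pose k := Num.truncn (`|fine s| / mean_const).
have := sk k; rewrite -(fineK s_num) lee_fin; apply/negP; rewrite -ltNge.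
rewrite mulrC -ltr_pdivrMr//.
apply: (@le_lt_trans _ _ (`|fine s| / mean_const)).
  by rewrite ler_wpM2r ?invr_ge0 ?(ltW m0)// ler_norm.
have : `|fine s| / mean_const < k.+1%:R by rewrite truncnS_gt.
by move/lt_le_trans; apply; rewrite ler_nat (ltn_scale a14 ab).
Qed.

End NotHardy.

(** * Majorants *)

Section Majorized.
Context d (T : measurableType d) (R : realType).
Context (mu : {measure set T -> \bar R}).
Implicit Types (f g : T -> \bar R) (A : set T) (V : R).

(** A bound for the integral of [f] over [A] through a measurable majorant. Such
    bounds add up over countable covers, for arbitrary [f] and [A]. *)
Definition majorized f A V : Prop := exists g : T -> \bar R,
  [/\ measurable_fun setT g, (forall x, 0 <= g x)%E,
      (forall x, A x -> f x <= g x)%E & (\int[mu]_x g x <= V%:E)%E].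

Lemma majorized_integral f A V : (forall x, A x -> 0 <= f x)%E ->
  majorized f A V -> (\int[mu]_(x in A) f x <= V%:E)%E.
Proof.
move=> f0 [g [mg g0 fg gV]]; apply: le_trans gV.
rewrite integral_mkcond; apply: ge0_le_integralT => x; rewrite patchE.
  by case: ifPn => //; rewrite inE => /f0.
by case: ifPn => //; rewrite inE => /fg.
Qed.

Lemma majorized_ge0 f A V : majorized f A V -> 0 <= V.
Proof.
move=> [g [_ g0 _ gV]]; rewrite -lee_fin; apply: le_trans gV.
exact: integral_ge0.
Qed.

Lemma majorizedS f A B V W : A `<=` B -> V <= W ->
  majorized f B V -> majorized f A W.
Proof.
move=> AB VW [g [mg g0 fg gV]]; exists g; split=> //.
  by move=> x /AB /fg.
by apply: le_trans gV _; rewrite lee_fin.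
Qed.

Lemma majorized_bigcup f (A : nat -> set T) (V : nat -> R) (W : R) :
  (forall k, majorized f (A k) (V k)) ->
  (forall n, \sum_(k < n) V k <= W) ->
  majorized f (\bigcup_k A k) W.
Proof.
move=> maj VW; have [g gP] := choice maj.
have g0 k x : (0 <= g k x)%E by have [_ + _ _] := gP k; apply.
have mg k : measurable_fun setT (g k) by have [+ _ _ _] := gP k; apply.
exists (fun x => \sum_(k <oo) g k x)%E; split.
- by apply: ge0_emeasurable_sum.
- by move=> x; exact: nneseries_ge0.
- move=> x [k _ Akx]; have [_ _ fg _] := gP k.
  apply: (le_trans (fg _ Akx)); apply: le_trans (nneseries_lim_ge k.+1 _) => //.
  by rewrite big_nat_recr//= leeDr// sume_ge0.
- rewrite integral_nneseries//.
  apply: lime_le; first by apply: is_cvg_nneseries => k _ _; exact: integral_ge0.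
  apply: nearW => n; rewrite big_mkord.
  apply: (@le_trans _ _ (\sum_(k < n) (V k)%:E)%E).
    by apply: lee_sum => k _; have [_ _ _] := gP k.
  by rewrite sumEFin lee_fin.
Qed.

Lemma majorized_set0 f : majorized f set0 0.
Proof.
exists (cst 0%E); split=> //.
by rewrite integral0.
Qed.

Lemma majorized_bigcup_lt f (A : nat -> set T) V n :
  (forall k, (k < n)%N -> majorized f (A k) V) ->
  majorized f [set x | exists2 k, (k < n)%N & A k x] (n%:R * V).
Proof.
move=> maj; case: n maj => [|n] maj.
  by apply: majorizedS (majorized_set0 f) => [x []//|]; rewrite mul0r.
have V0 := majorized_ge0 (maj 0 isT).
apply: (@majorizedS _ _ (\bigcup_k (if (k < n.+1)%N then A k else set0)) _ _ _ (lexx _)).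
  by move=> x [k kn Akx]; exists k => //; rewrite kn.
apply: (@majorized_bigcup _ _ (fun k => if (k < n.+1)%N then V else 0)) => [k|i].
  by case: ifPn => [/maj//|_]; exact: majorized_set0.
by rewrite sum_if_lt ler_wpM2r// ler_nat geq_minr.
Qed.

Lemma majorizedU f A B V W : majorized f A V -> majorized f B W ->
  majorized f (A `|` B) (V + W).
Proof.
move=> [g [mg g0 fg gV]] [h [mh h0 fh hW]].
exists (fun x => g x + h x)%E; split.
- exact: emeasurable_funD.
- by move=> x; exact: adde_ge0.
- move=> x [/fg|/fh] h1; apply: (le_trans h1); first by rewrite leeDl.
  by rewrite leeDr.
- by rewrite ge0_integralD// EFinD leeD.
Qed.

Lemma majorized_cst f A (c v : R) : measurable A -> 0 <= c ->
  (forall x, A x -> f x <= c%:E)%E -> (mu A <= v%:E)%E ->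
  majorized f A (c * v).
Proof.
move=> mA c0 fc Av; exists (fun x => (c * \1_A x)%:E); split.
- by apply/measurable_EFinP; apply: measurable_funM => //; exact: measurable_cst.
- by move=> x; rewrite lee_fin mulr_ge0.
- by move=> x Ax; rewrite indicE mem_set//= mulr1; exact: fc.
- under eq_integral do rewrite EFinM.
  rewrite ge0_integralZl//; last by apply/measurable_EFinP.
  by rewrite integral_indic// setIT EFinM lee_wpmul2l.
Qed.

End Majorized.

(** * Area of thin pieces of the disk near the circle *)

Section AreaEstimate.
Context {R : realType}.
Implicit Types (zeta w : @plane R) (s y u v : R).

HB.instance Definition _ := Measure.copy (@area R)
  (@lebesgue_measure R \x @lebesgue_measure R)%E.

Definition depth w : R := 1 - cnorm (cplx w).

Lemma measurable_depth : measurable_fun setT depth.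
Proof.
apply: measurable_funB; first exact: measurable_cst.
exact: (measurable_cnorm (@cmeasurable_cplx R)).
Qed.

Lemma measurable_dist zeta :
  measurable_fun setT (fun w => cnorm (cplx w - cplx zeta)).
Proof.
apply: measurable_cnorm; apply: cmeasurableB; first exact: cmeasurable_cplx.
exact: cmeasurable_cst.
Qed.

(** The part of the annulus [y / 2 <= 1 - |w| <= y] close to [zeta]; for [zeta] on
    the circle it is a curved rectangle of sides [s] and [y]. *)
Definition patch_near zeta s y : set (@plane R) :=
  [set w | y / 2 <= depth w <= y /\ cnorm (cplx w - cplx zeta) <= s].

Lemma measurable_patch_near zeta s y : measurable (patch_near zeta s y).
Proof.
rewrite (_ : patch_near _ _ _ = (setT `&` depth @^-1` `[y / 2, y]) `&`
   (setT `&` (fun w => cnorm (cplx w - cplx zeta)) @^-1` `]-oo, s])).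
  apply: measurableI; first exact: measurable_depth.
  exact: measurable_dist.
by rewrite !setTI; apply/seteqP; split=> w; rewrite /patch_near/= !in_itv/=.
Qed.

Lemma lebesgue_measure_diam_le (V : set R) (y : R) : measurable V -> 0 <= y ->
  (forall v v', V v -> V v' -> `|v - v'| <= y) ->
  (@lebesgue_measure R V <= (2 * y)%:E)%E.
Proof.
move=> mV y0 Vd; have [->|/set0P[v0 Vv0]] := eqVneq V set0.
  by rewrite measure0 lee_fin mulr_ge0.
apply: (@le_trans _ _ (@lebesgue_measure R `[v0 - y, v0 + y]%classic)).
  apply: le_measure; rewrite ?inE//.
  move=> v Vv /=; rewrite in_itv/=.
  by have := Vd _ _ Vv Vv0; rewrite ler_distl => /andP[-> ->].
rewrite lebesgue_measure_itv/=; case: ifPn => _; last by rewrite lee_fin mulr_ge0.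
by rewrite -EFinD lee_fin; lra.
Qed.

(** Along a line on which the other coordinate is fixed, the squares of two
    points of the annulus differ by at most [y]; away from the axis this
    bounds their distance. *)
Lemma annulus_chord_le (be v v' D D' q : R) (y : R) :
  2^-1 <= be ^+ 2 -> `|v - be| <= 4^-1 -> `|v' - be| <= 4^-1 ->
  0 < y <= 1 -> y / 2 <= 1 - D <= y -> y / 2 <= 1 - D' <= y ->
  0 <= D -> 0 <= D' -> D ^+ 2 = q + v ^+ 2 -> D' ^+ 2 = q + v' ^+ 2 ->
  `|v - v'| <= 2 * y.
Proof.
move=> be2; rewrite !ler_distl => /andP[v1 v2] /andP[v1' v2'] /andP[y0 y1].
move=> /andP[d1 d2] /andP[d1' d2'] D0 D0' DE DE'.
have k1 : D ^+ 2 - D' ^+ 2 <= y.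
  have : D ^+ 2 <= (1 - y / 2) ^+ 2 by rewrite ler_sqr ?nnegrE; lra.
  have : (1 - y) ^+ 2 <= D' ^+ 2 by rewrite ler_sqr ?nnegrE; lra.
  by nra.
have k2 : D' ^+ 2 - D ^+ 2 <= y.
  have : D' ^+ 2 <= (1 - y / 2) ^+ 2 by rewrite ler_sqr ?nnegrE; lra.
  have : (1 - y) ^+ 2 <= D ^+ 2 by rewrite ler_sqr ?nnegrE; lra.
  by nra.
have E : D ^+ 2 - D' ^+ 2 = (v - v') * (v + v') by rewrite DE DE'; ring.
have E' : D' ^+ 2 - D ^+ 2 = (v' - v) * (v + v') by rewrite DE DE'; ring.
rewrite E in k1; rewrite E' in k2.
case: (lerP 0 be) => be0.
  have b1 : 2^-1 <= be by rewrite leNgt; apply/negP => h; nra.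
  have vv : 2^-1 <= v + v' by lra.
  by apply/andP; split; nra.
have b1 : be <= - 2^-1 by rewrite leNgt; apply/negP => h; nra.
have vv : v + v' <= - 2^-1 by lra.
by apply/andP; split; nra.
Qed.

(** Used for the measures of the sections of a planar set contained in a strip. *)
Lemma integral_strip_le (F : R -> \bar R) (al s c : R) : 0 <= s -> 0 <= c ->
  (forall u, 0 <= F u)%E -> (forall u, `|u - al| <= s -> (F u <= c%:E)%E) ->
  (forall u, s < `|u - al| -> F u = 0%E) ->
  (\int[@lebesgue_measure R]_u F u <= (c * (2 * s))%:E)%E.
Proof.
move=> s0 c0 F0 Fc Fz.
pose A := `[al - s, al + s]%classic.
have mA : measurable A by exact: measurable_itv.
have LA : (@lebesgue_measure R A <= (2 * s)%:E)%E.
  rewrite /A lebesgue_measure_itv/=; case: ifPn => _; last by rewrite lee_fin mulr_ge0.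
  by rewrite -EFinD lee_fin; lra.
apply: (@le_trans _ _ (\int[@lebesgue_measure R]_u (c * \1_A u)%:E)%E).
  apply: ge0_le_integralT => // u.
  have [us|us] := lerP `|u - al| s; last by rewrite Fz// lee_fin mulr_ge0.
  rewrite indicE mem_set/= ?mulr1 ?Fc//.
  by rewrite /A/= in_itv/= -ler_distl.
under eq_integral do rewrite EFinM.
rewrite ge0_integralZl//; last by apply/measurable_EFinP.
rewrite integral_indic// setIT EFinM lee_wpmul2l//.
Qed.

(** Integrate along the lines parallel to the axis of the coordinate in which
    [zeta] is the larger: by [annulus_chord_le] they meet the patch in sets of
    diameter at most [2 y]. *)
Lemma area_patch_near_le zeta s y : unit_circle zeta -> 0 <= s <= 4^-1 ->
  0 < y <= 1 -> (area (patch_near zeta s y) <= (8 * s * y)%:E)%E.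
Proof.
move=> uz /andP[s0 s4] /andP[y0 y1].
have mT := measurable_patch_near zeta s y.
have zE : zeta.1 ^+ 2 + zeta.2 ^+ 2 = 1.
  by have := cnorm_sqr (cplx zeta); rewrite uz expr1n.
have yy : 0 < y <= 1 by rewrite y0 y1.
have d1 w : patch_near zeta s y w -> `|w.1 - zeta.1| <= s.
  move=> [_]; apply: le_trans; have := le_Re_cnorm (cplx w - cplx zeta).
  by rewrite cReD cReN.
have d2 w : patch_near zeta s y w -> `|w.2 - zeta.2| <= s.
  move=> [_]; apply: le_trans; have := le_Im_cnorm (cplx w - cplx zeta).
  by rewrite cImD cImN.
have cn w : cnorm (cplx w) ^+ 2 = w.1 ^+ 2 + w.2 ^+ 2 by rewrite cnorm_sqr.
have -> : 8 * s * y = (2 * (2 * y)) * (2 * s) by ring.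
have c0 : 0 <= 2 * (2 * y) by rewrite !mulr_ge0// ltW.
have y20 : 0 <= 2 * y by rewrite mulr_ge0// ltW.
have [h2|h1] : 2^-1 <= zeta.2 ^+ 2 \/ 2^-1 <= zeta.1 ^+ 2.
- by case: (lerP 2^-1 (zeta.2 ^+ 2)) => h; [left|right; lra].
- rewrite /area /product_measure1; apply: (@integral_strip_le _ zeta.1) => //=.
    move=> u _; apply: lebesgue_measure_diam_le => //.
      exact: measurable_xsection.
    move=> v v'; rewrite /xsection/= !inE => Tv Tv'.
    have [[dv _] [dv' _]] := (Tv, Tv').
    apply: (@annulus_chord_le zeta.2 v v' (cnorm (cplx (u, v)))
      (cnorm (cplx (u, v'))) (u ^+ 2)) => //; rewrite ?cnorm_ge0 ?cn//.
      exact: le_trans (d2 _ Tv) s4.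
    exact: le_trans (d2 _ Tv') s4.
  move=> u us; rewrite (_ : xsection _ _ = set0) ?measure0//.
  rewrite -subset0 => v; rewrite /xsection/= inE => /d1/= us'.
  by move: us; rewrite ltNge us'.
- rewrite (_ : area _ = \int[@lebesgue_measure R]_v
      (@lebesgue_measure R \o ysection (patch_near zeta s y)) v)%E; last first.
    rewrite /area (@product_measure_unique _ _ _ _ _ lebesgue_measure
      lebesgue_measure (lebesgue_measure \x^ lebesgue_measure)%E)//.
    by move=> A B mA mB; exact: product_measure2E.
  apply: (@integral_strip_le _ zeta.2) => //=.
    move=> v _; apply: lebesgue_measure_diam_le => //.
      exact: measurable_ysection.
    move=> u u'; rewrite /ysection/= !inE => Tu Tu'.
    have [[du _] [du' _]] := (Tu, Tu').
    apply: (@annulus_chord_le zeta.1 u u' (cnorm (cplx (u, v)))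
      (cnorm (cplx (u', v))) (v ^+ 2)) => //; rewrite ?cnorm_ge0 ?cn//=.
    - exact: le_trans (d1 _ Tu) s4.
    - exact: le_trans (d1 _ Tu') s4.
    - exact: addrC.
    - exact: addrC.
  move=> v vs; rewrite (_ : ysection _ _ = set0) ?measure0//.
  rewrite -subset0 => u; rewrite /ysection/= inE => /d2/= us'.
  by move: vs; rewrite ltNge us'.
Qed.

Definition closed_disk : set (@plane R) := [set w | cnorm (cplx w) <= 1].

Lemma measurable_closed_disk : measurable closed_disk.
Proof.
rewrite (_ : closed_disk = setT `&` (fun w => cnorm (cplx w)) @^-1` `]-oo, 1]).
  by apply: (measurable_cnorm (@cmeasurable_cplx R)).
by rewrite setTI; apply/seteqP; split=> w /=; rewrite in_itv.
Qed.

Lemma area_closed_disk_le : (area closed_disk <= 8%:E)%E.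
Proof.
have mD := measurable_closed_disk.
have -> : 8 = (2 * 2) * (2 * 1) :> R by ring.
rewrite /area /product_measure1; apply: (@integral_strip_le _ 0) => //=.
  move=> u _; apply: lebesgue_measure_diam_le => //.
    exact: measurable_xsection.
  move=> v v'; rewrite /xsection/= !inE /closed_disk => Dv Dv'.
  have := le_trans (le_Im_cnorm _) Dv; have := le_trans (le_Im_cnorm _) Dv'.
  move=> /= h h'; rewrite (le_trans (ler_normB _ _))//.
  lra.
move=> u us; rewrite (_ : xsection _ _ = set0) ?measure0//.
rewrite -subset0 => v; rewrite /xsection/= inE /closed_disk => Dv.
have h : `|u| <= 1 := le_trans (le_Re_cnorm _) Dv.
by move: us; rewrite subr0 ltNge h.
Qed.

End AreaEstimate.

(** * The weighted area of horodisks *)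

Section Horodisk.
Context {R : realType} (p : R) (p0 : 0 < p) (p_half : p < 1 / 2).
Implicit Types (zeta w : @plane R) (K Y y : R).

Definition weight w : R := (depth w `^ (1 + p))^-1.

(** Comparable to the disk of diameter [1 / K] internally tangent to the unit
    circle at [zeta]. *)
Definition horodisk zeta K : set (@plane R) :=
  [set w | 0 < depth w /\ K * cnorm (cplx w - cplx zeta) ^+ 2 <= depth w].

Local Notation maj := (majorized (@area R) (fun w => (weight w)%:E)).

Lemma weight_le w y : 0 < y -> y <= depth w -> weight w <= y `^ (- (1 + p)).
Proof.
move=> y0 yd; rewrite powRN /weight lef_pV2 ?posrE ?powR_gt0//.
  apply: ge0_ler_powR; rewrite ?nnegrE ?(ltW y0)//.
    by rewrite addr_ge0// ltW.
  exact: le_trans (ltW y0) yd.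
exact: lt_le_trans yd.
Qed.

(** The ratio of the costs of two consecutive dyadic slices of a horodisk; it is
    less than [1] exactly because [p < 1/2]. *)
Definition slice_ratio : R := 2^-1 `^ (2^-1 - p).

Lemma slice_ratio_bounds : 0 < slice_ratio < 1.
Proof.
rewrite /slice_ratio powR_gt0//=.
have h : 2^-1 < 1 :> R by lra.
have e : 0 < 2^-1 - p by have := p_half; lra.
rewrite -[ltRHS](_ : 1 `^ (2^-1 - p) = 1); last by rewrite powR1.
by apply: gt0_ltr_powR; rewrite ?nnegrE ?invr_ge0.
Qed.

Definition horodisk_const : R := 8 * 2 `^ (1 + p) * (1 - slice_ratio)^-1.

(** The left-hand side bounds the slice [y / 2 <= 1 - |w| <= y] with
    [y = Y 2 ^ (- n)]: the weight there is at most [(y / 2) ^ (- 1 - p)], and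
    the slice is a patch of width [sqrt (y / K)]. *)
Lemma slice_cost K Y n : 0 < K -> 0 < Y ->
  (Y * 2^-1 ^+ n / 2) `^ (- (1 + p)) *
    (8 * Num.sqrt (Y * 2^-1 ^+ n / K) * (Y * 2^-1 ^+ n)) =
  8 * 2 `^ (1 + p) * (K `^ (- 2^-1) * Y `^ (2^-1 - p)) * slice_ratio ^+ n.
Proof.
move=> K0 Y0.
have y0 : 0 < Y * 2^-1 ^+ n by rewrite mulr_gt0// exprn_gt0.
have E : (Y * 2^-1 ^+ n) `^ (2^-1 - p) = Y `^ (2^-1 - p) * slice_ratio ^+ n.
  rewrite powRM ?(ltW Y0) ?exprn_ge0//; congr (_ * _).
  by rewrite -!powR_mulrn ?powR_ge0// /slice_ratio powRAC.
set y := Y * _ in y0 E *.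
rewrite -powR12_sqrt ?divr_ge0 ?(ltW y0) ?(ltW K0)//.
rewrite (powRM _ (ltW y0)) ?invr_ge0// (powRM _ (ltW y0)) ?invr_ge0 ?(ltW K0)//.
have -> : 2^-1 `^ (- (1 + p)) = 2 `^ (1 + p) :> R.
  by rewrite -[2^-1]powR_inv1// -powRrM mulN1r opprK.
have -> : K^-1 `^ 2^-1 = K `^ (- 2^-1).
  by rewrite -[K^-1]powR_inv1 ?(ltW K0)// -powRrM mulN1r.
have E2 : y `^ (2^-1 - p) = y `^ (- (1 + p)) * y `^ 2^-1 * y.
  rewrite -[X in _ * X](powRr1 (ltW y0)) -!powRD ?(lt0r_neq0 y0) ?implybT//.
  by congr (_ `^ _); lra.
transitivity (8 * 2 `^ (1 + p) * K `^ (- 2^-1) * y `^ (2^-1 - p)).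
  by rewrite E2; ring.
by rewrite E; ring.
Qed.

(** The costs of the dyadic slices form a geometric series. The condition
    [16 Y <= K] keeps the patches within distance [1/4] of [zeta]. *)
Lemma horodisk_near_majorized zeta K Y : unit_circle zeta -> 0 < K ->
  0 < Y <= 1 -> 16 * Y <= K ->
  maj (horodisk zeta K `&` [set w | depth w <= Y])
      (horodisk_const * (K `^ (- 2^-1) * Y `^ (2^-1 - p))).
Proof.
move=> uz K0 /andP[Y0 Y1] YK.
have /andP[q0 q1] := slice_ratio_bounds.
pose y n : R := Y * 2^-1 ^+ n.
have y0 n : 0 < y n by rewrite mulr_gt0// exprn_gt0.
have yY n : y n <= Y by rewrite ler_piMr ?(ltW Y0)// exprn_ile1//; lra.
pose s n : R := Num.sqrt (y n / K).
have s4 n : 0 <= s n <= 4^-1.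
  rewrite sqrtr_ge0/=.
  have -> : 4^-1 = Num.sqrt ((4^-1) ^+ 2) :> R by rewrite sqrtr_sqr ger0_norm.
  apply: ler_wsqrtr; rewrite ler_pdivrMr//.
  by have := yY n; lra.
have cover : horodisk zeta K `&` [set w | depth w <= Y] `<=`
    \bigcup_n patch_near zeta (s n) (y n).
  move=> w [[d0 dK] dY] /=.
  have ex : exists n, Y * 2^-1 ^+ n.+1 <= depth w.
    exists (Num.truncn (Y / depth w)).
    set n := Num.truncn _.
    rewrite exprVn ler_pdivrMr ?exprn_gt0// -ler_pdivrMl// mulrC.
    apply: (@le_trans _ _ n.+1%:R); first by apply: ltW; exact: truncnS_gt.
    by rewrite -natrX ler_nat ltnW// ltn_expl.
  have [n Pn nmin] := find_ex_minn ex.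
  exists n => //; split.
    rewrite /y; apply/andP; split; first by move: Pn; rewrite exprSr mulrA.
    case: n Pn nmin => [|n] _ nmin; first by rewrite expr0 mulr1.
    rewrite leNgt; apply/negP => /ltW /nmin; by rewrite ltnn.
  have dn : depth w <= y n.
    case: n Pn nmin => [|n] _ nmin; first by rewrite /y expr0 mulr1.
    rewrite leNgt; apply/negP => /ltW /nmin; by rewrite ltnn.
  rewrite -[leLHS]ger0_norm ?cnorm_ge0// -sqrtr_sqr; apply: ler_wsqrtr.
  by rewrite ler_pdivlMr// mulrC (le_trans dK).
apply: (majorizedS cover (lexx _)).
apply: (@majorized_bigcup _ _ _ _ _ _
  (fun n => (y n / 2) `^ (- (1 + p)) * (8 * s n * y n))).
  move=> n; apply: majorized_cst.
  - exact: measurable_patch_near.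
  - exact: powR_ge0.
  - move=> w [/andP[h _] _]; rewrite lee_fin; apply: weight_le => //.
    by rewrite divr_gt0.
  - by apply: area_patch_near_le => //; rewrite y0 (le_trans (yY n)).
move=> n; under eq_bigr do rewrite slice_cost//.
rewrite -mulr_sumr /horodisk_const [leRHS]mulrAC ler_wpM2l//.
  by rewrite !mulr_ge0 ?powR_ge0.
have h : 0 < 1 - slice_ratio by rewrite subr_gt0.
rewrite -[leRHS]mul1r ler_pdivlMr// mulrC -opprB mulNr -subrX1 opprB.
by rewrite gerBl exprn_ge0// ltW.
Qed.

Lemma depth_le_dist zeta w : unit_circle zeta ->
  depth w <= cnorm (cplx w - cplx zeta).
Proof. by move=> uz; rewrite cnormBC /depth -uz; exact: lerB_cnorm. Qed.

(** The whole horodisk lies in [1 - |w| <= 1 / K], because [1 - |w|] is at most the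
    distance from [w] to [zeta]. *)
Lemma horodisk_majorized zeta K : unit_circle zeta -> 4 <= K ->
  maj (horodisk zeta K) (horodisk_const * K `^ (p - 1)).
Proof.
move=> uz K4; have K0 : 0 < K by lra.
have -> : K `^ (p - 1) = K `^ (- 2^-1) * K^-1 `^ (2^-1 - p).
  rewrite -[K^-1]powR_inv1 ?(ltW K0)// -powRrM -powRD ?(lt0r_neq0 K0) ?implybT//.
  by congr (_ `^ _); lra.
have KV : K^-1 <= 4^-1 by rewrite lef_pV2 ?posrE.
have KV0 : 0 < K^-1 by rewrite invr_gt0.
apply: majorizedS (horodisk_near_majorized uz K0 _ _) => //; last 2 first.
- by rewrite KV0; lra.
- by lra.
move=> w [d0 dK]; split=> //=.
have dd := depth_le_dist w uz.
set D := cnorm (cplx w - cplx zeta) in dK dd.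
have D0 : 0 < D by exact: lt_le_trans dd.
rewrite -[leRHS]mul1r ler_pdivlMr//.
have : K * D <= 1.
  by rewrite -(ler_pM2r D0) mul1r -mulrA -expr2 (le_trans dK).
by apply: le_trans; rewrite mulrC ler_wpM2l// ltW.
Qed.

Lemma far_majorized Y : 0 < Y ->
  maj [set w | Y <= depth w] (Y `^ (- (1 + p)) * 8).
Proof.
move=> Y0; have cover : [set w | Y <= depth w] `<=`
    [set w | Y <= depth w] `&` @closed_disk R.
  move=> w /= Yw; split=> //; rewrite /closed_disk/=.
  by have h := lt_le_trans Y0 Yw; apply: ltW; rewrite -subr_gt0.
have mA : measurable ([set w | Y <= depth w] `&` @closed_disk R).
  apply: measurableI; last exact: measurable_closed_disk.
  rewrite (_ : [set w | Y <= depth w] = setT `&` (@depth R) @^-1` `[Y, +oo[).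
    exact: measurable_depth.
  by rewrite setTI; apply/seteqP; split=> w /=; rewrite in_itv/= andbT.
apply: (majorizedS cover (lexx _)); apply: majorized_cst.
- exact: mA.
- exact: powR_ge0.
- by move=> w [Yw _]; rewrite lee_fin weight_le.
- apply: le_trans (@area_closed_disk_le R); apply: le_measure; rewrite ?inE.
  + exact: mA.
  + exact: measurable_closed_disk.
  + by move=> w [].
Qed.

(** For small [K] the slicing only applies near the circle; on the rest of the
    disk the weight is bounded. *)
Lemma horodisk_majorized_ex zeta K : unit_circle zeta -> 0 < K ->
  exists V, maj (horodisk zeta K) V.
Proof.
move=> uz K0; pose Y := Num.min 1 (K / 16).
have Y0 : 0 < Y by rewrite lt_min ltr01 divr_gt0.
have Y1 : Y <= 1 by rewrite ge_min lexx.
have YK : 16 * Y <= K by rewrite mulrC -ler_pdivlMr// ge_min lexx orbT.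
have Y01 : 0 < Y <= 1 by rewrite Y0.
have h := horodisk_near_majorized uz K0 Y01 YK.
eexists; apply: majorizedS (majorizedU h (far_majorized Y0)) => //.
move=> w hw; case: (lerP (depth w) Y) => dY; first by left; split.
by right; exact: ltW.
Qed.

End Horodisk.

(** * Sublevel sets of the stages *)

Section StageSublevel.
Context {R : realType}.
Implicit Types (z w : R[i]).

Lemma polar_atan w : 0 < Re w ->
  w = (cnorm w)%:C * cexp (0 +i* atan (Im w / Re w)).
Proof.
move=> w0; set x := Im w / Re w.
have xE : Im w = x * Re w by rewrite /x divfK// lt0r_neq0.
have s0 : 0 < 1 + x ^+ 2 by rewrite ltr_pwDl// sqr_ge0.
have nE : cnorm w = Re w * Num.sqrt (1 + x ^+ 2).
  apply/eqP; rewrite -(@eqrXn2 _ 2)// ?cnorm_ge0 ?mulr_ge0 ?sqrtr_ge0 ?(ltW w0)//.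
  by rewrite exprMn sqr_sqrtr ?(ltW s0)// cnorm_sqr xE; apply/eqP; ring.
have q0 : Num.sqrt (1 + x ^+ 2) != 0 by rewrite gt_eqF// sqrtr_gt0.
have cE : cnorm w * cos (atan x) = Re w by rewrite cos_atan nE mulfK.
have c0 : cos (atan x) != 0 by rewrite cos_atan invr_eq0.
have sE : sin (atan x) = x * cos (atan x).
  by rewrite -[X in _ = X * _]atanK /tan divfK.
apply: complex_ext; rewrite ?cReMr ?cImMr /cexp /= expR0.
  by rewrite mul1r cE.
by rewrite mul1r sE mulrCA cE.
Qed.

(** If [z ^ n] is near [1] then [z] is near an [n]-th root of unity: the
    principal [n]-th root [u] of [z ^ n] is explicit, and [z / u] is a root of
    unity. *)
Lemma near_unity_root z n : (0 < n)%N -> z != 0 -> cnorm z <= 1 ->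
  2^-1 <= Re (z ^+ n) ->
  exists2 j, (j < n)%N & cnorm (z - cplx (root_point n j)) <=
    (1 - cnorm z) + 2 * cnorm (1 - z ^+ n) / n%:R.
Proof.
move=> n0 z0 z1 rz.
have nR : 0 < n%:R :> R by rewrite ltr0n.
set w := z ^+ n in rz *.
have w0 : 0 < Re w by apply: lt_le_trans rz; rewrite invr_gt0.
set phi := atan (Im w / Re w).
pose v : R[i] := cexp (0 +i* (phi / n%:R)).
pose u : R[i] := (cnorm z)%:C * v.
have zn0 : 0 < cnorm z by rewrite cnorm_gt0.
have un : u ^+ n = w.
  rewrite /u /v polarX [n%:R * _]mulrC divfK ?lt0r_neq0// [RHS]polar_atan//.
  by rewrite /w cnormX.
have v1 : cnorm v = 1 by rewrite cnorm_cexp/= expR0.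
have u0 : u != 0 by rewrite -cnorm_gt0 cnormM cnormR v1 mulr1 normr_gt0 gt_eqF.
have /(prim_rootP (unity_root_primitive n0))[j zu] : (z / u) ^+ n = 1.
  by rewrite exprMn exprVn un divff// expf_neq0.
exists j; first exact: ltn_ord.
rewrite -unity_rootX -zu.
have zE : z = (z / u) * u by rewrite divfK.
have nzu : cnorm (z / u) = 1.
  by rewrite zu unity_rootX; exact: unit_circle_root.
have -> : z - z / u = (z / u) * (u - 1) by rewrite mulrBr mulr1 -zE.
rewrite cnormM nzu mul1r.
have -> : u - 1 = ((cnorm z)%:C - 1) * v + (v - 1) by rewrite /u; ring.
rewrite (le_trans (ler_cnormD _ _))// lerD//.
  rewrite cnormM v1 mulr1 -(rmorph1 (real_complex R)) -rmorphB cnormR distrC.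
  by rewrite ger0_norm// subr_ge0.
apply: (le_trans (cnorm_cis_sub1 _)).
rewrite normrM [X in _ * X]ger0_norm ?invr_ge0// ler_pM2r ?invr_gt0//.
apply: (le_trans (ler_abs_atan _)).
rewrite normrM normfV [X in _ / X]ger0_norm ?(ltW w0)// ler_pdivrMr//.
have h : `|Im w| <= cnorm (1 - w).
  by have := le_Im_cnorm (1 - w); rewrite cImD cImN/= add0r normrN.
apply: (le_trans h); rewrite mulrAC ler_peMl ?cnorm_ge0//.
by lra.
Qed.

(** The sublevel set of one stage, the preimage of a horodisk under
    [z |-> z ^ n], lies in [n] horodisks. *)
Lemma preimage_horodisk z n (eps : R) : (0 < n)%N -> cnorm z < 1 ->
  0 < eps <= 4^-1 ->
  cnorm (1 - z ^+ n) ^+ 2 <= eps * (1 - cnorm z ^+ (2 * n)) ->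
  exists2 j, (j < n)%N &
    n%:R / (24 * eps) * cnorm (z - cplx (root_point n j)) ^+ 2 <= 1 - cnorm z.
Proof.
move=> n0 z1 /andP[e0 e4] H.
have nR : 0 < n%:R :> R by rewrite ltr0n.
set r := cnorm z in z1 H *; have r0 : 0 <= r by exact: cnorm_ge0.
set rho := r ^+ n; set D := cnorm (1 - z ^+ n) in H *.
have rho01 : 0 <= rho <= 1 by rewrite exprn_ge0 ?exprn_ile1// ltW.
have rho1 : rho < 1 by rewrite exprn_ilt1// -lt0n.
have {}H : D ^+ 2 <= eps * (1 - rho ^+ 2) by rewrite -exprM mulnC.
have D0 : 0 <= D by exact: cnorm_ge0.
have Dr : 1 - rho <= D.
  by apply: le_trans (lerB_cnorm _ _); rewrite cnorm1 cnormX.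
have rho2 : 1 - rho <= 2 * eps.
  have h : (1 - rho) * (1 - rho) <= (1 - rho) * (2 * eps).
    apply: (@le_trans _ _ (D ^+ 2)); first by rewrite expr2 ler_pM// subr_ge0 ltW.
    by apply: (le_trans H); move: rho1 rho01 => ? /andP[? ?]; nra.
  by move: h; rewrite ler_pM2l// subr_gt0.
have rho12 : 2^-1 <= rho by lra.
have D12 : D <= 2^-1.
  have : D ^+ 2 <= 4^-1 by apply: (le_trans H); move: rho01 => /andP[? ?]; nra.
  by move=> h; rewrite leNgt; apply/negP => h'; nra.
have ny1 : n%:R * (1 - r) * rho <= 1 - rho.
  have := @expr1B_mul_le1 R (1 - r) n.
  rewrite (_ : 1 - (1 - r) = r); last by ring.
  rewrite -/rho => /(_ _) h; rewrite subr_ge0 (ltW z1)/= in h.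
  have {}h := h ltac:(lra); lra.
have ny2 : 1 - rho <= n%:R * (1 - r).
  have := @bernoulli_le R (r - 1) n; rewrite (_ : 1 + (r - 1) = r); last by ring.
  by rewrite -/rho => /(_ ltac:(lra)); lra.
have nye : n%:R * (1 - r) <= 4 * eps.
  have : 0 <= n%:R * (1 - r) by rewrite mulr_ge0// subr_ge0 ltW.
  move: (n%:R * (1 - r)) ny1 => t t1 t0; nra.
have rw : 2^-1 <= Re (z ^+ n).
  have := le_Re_cnorm (1 - z ^+ n); rewrite cReD cReN/= -/D => /(le_trans (ler_norm _)).
  by lra.
have z0 : z != 0.
  apply/eqP => z0.
  have rho0 : rho = 0 by rewrite /rho /r z0 cnorm0 expr0n gtn_eqF.
  by move: rho12; rewrite rho0; lra.
have [j jn dj] := near_unity_root n0 z0 (ltW z1) rw.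
exists j => //; rewrite -/r -/D in dj.
set d := cnorm (z - _) in dj *.
have d0 : 0 <= d by exact: cnorm_ge0.
rewrite mulrAC ler_pdivrMr ?mulr_gt0//.
set y := 1 - r in dj nye ny2 *; have y0 : 0 <= y by rewrite subr_ge0 ltW.
have y1 : 0 <= 2 * D / n%:R by rewrite !mulr_ge0// invr_ge0.
have dd : d ^+ 2 <= 2 * y ^+ 2 + 2 * (2 * D / n%:R) ^+ 2.
  have : d ^+ 2 <= (y + 2 * D / n%:R) ^+ 2 by rewrite ler_sqr ?nnegrE// addr_ge0.
  move: (2 * D / n%:R) => t h; have := sqr_ge0 (y - t); nra.
have DD : D ^+ 2 <= 2 * eps * (n%:R * y).
  apply: (le_trans H); rewrite [2 * eps]mulrC -mulrA ler_wpM2l ?(ltW e0)//.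
  by move: rho01 => /andP[? ?]; move: ny2; move: (n%:R * y) => t; nra.
apply: (@le_trans _ _ (n%:R * (2 * y ^+ 2 + 2 * (2 * D / n%:R) ^+ 2))).
  by rewrite ler_pM2l.
have -> : n%:R * (2 * y ^+ 2 + 2 * (2 * D / n%:R) ^+ 2) =
    2 * (n%:R * y) * y + 8 * (D ^+ 2 / n%:R) by field; exact: lt0r_neq0.
have DDn : D ^+ 2 / n%:R <= 2 * eps * y.
  by rewrite ler_pdivrMr// -!mulrA [y * _]mulrC mulrA.
have : n%:R * y * y <= 4 * eps * y by rewrite ler_wpM2r.
lra.
Qed.

End StageSublevel.

(** * The weighted area of the sublevel sets *)

Section Sublevel.
Context {R : realType} (p : R) (a b : nat).
Context (p0 : 0 < p) (p_half : p < 1 / 2).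
Context (a14 : (14 <= a)%N) (ab : (a.+2 <= b)%N).
Context (bp : b.+1%:R <= (2 * b - a - 1)%:R * (1 - p)).

Local Notation X k := ((scale b k)%:R : R).
Local Notation N := (order b).
Local Notation m := (mass (R := R) a b).
Local Notation mu := (finite_atomic (sum_massM_order_le (R := R) a14 ab)).
Local Notation maj := (majorized (@area R) (fun w => (weight p w)%:E)).

Definition stage_sublevel k (dl : R) : set (@plane R) :=
  [set w | 0 < depth w /\ dl <= stage_poisson m N k (cplx w)].

Lemma depth_gt0 (w : @plane R) : (0 < depth w) = (cnorm (cplx w) < 1).
Proof. by rewrite /depth subr_gt0. Qed.

Lemma Re_herglotz (z : R[i]) (w : @plane R) : cnorm z < 1 -> unit_circle w ->
  Re (herglotz z w) = (1 - cnorm z ^+ 2) / cnorm (cplx w - z) ^+ 2.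
Proof.
move=> z1 uw.
have w1 : Re (cplx w) ^+ 2 + Im (cplx w) ^+ 2 = 1.
  by rewrite -cnorm_sqr uw expr1n.
rewrite /herglotz cReM cReV cImV !cReD !cImD !cReN !cImN !cnorm_sqr.
rewrite !cReD !cImD !cReN !cImN mulrA mulrA -mulrBl.
congr (_ / _); rewrite -w1.
case: z z1 {w1 uw} => zx zy _; case: w => wx wy /=; ring.
Qed.

Lemma mass_gt0 k : 0 < (m k)%:num.
Proof.
have NR : 0 < ((N k)%:R : R) by rewrite ltr0n (order_gt0 a14 ab).
by rewrite /mass/= divr_gt0// exprn_gt0// (scale_gt0 a14 ab).
Qed.

(** One of the [N k] atoms contributes at least the average. *)
Lemma stage_sublevel_majorized_ex k dl : 0 < dl ->
  exists V, maj (stage_sublevel k dl) V.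
Proof.
move=> dl0; have m0 := mass_gt0 k.
have N0 := order_gt0 a14 ab k.
have NR : 0 < ((N k)%:R : R) by rewrite ltr0n.
pose K := dl / (2 * ((m k)%:num * (N k)%:R)).
have K0 : 0 < K by rewrite divr_gt0// mulr_gt0// mulr_gt0.
have [V VP] := choice (fun j => horodisk_majorized_ex p0 p_half
  (unit_circle_root (N k) j) K0).
pose W := \sum_(j < N k) V j.
have VW j : (j < N k)%N -> V j <= W.
  move=> jN; rewrite /W (bigD1 (Ordinal jN))//= lerDl sumr_ge0// => i _.
  exact: majorized_ge0 (VP i).
exists ((N k)%:R * W).
have cover : stage_sublevel k dl `<=` [set w | exists2 j, (j < N k)%N &
    horodisk (root_point (N k) j) K w].
  move=> w [d0 hw] /=.
  have z1 : cnorm (cplx w) < 1 by rewrite -depth_gt0.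
  (* If no atom did, the stage would be smaller than [dl]. *)
  apply: contrapT => hno; move: hw; apply/negP; rewrite -ltNge.
  rewrite -stage_sum_herglotz//; last exact: (order_gt0 a14 ab).
  rewrite /stage_sum.
  have small j : (j < N k)%N ->
      Re (herglotz (cplx w) (root_point (N k) j)) < dl / ((m k)%:num * (N k)%:R).
    move=> jN; rewrite ltNge; apply/negP => hj; apply: hno; exists j => //.
    have uj := unit_circle_root (N k) j : unit_circle (root_point (N k) j).
    have D0 : 0 < cnorm (cplx (root_point (N k) j) - cplx w).
      by rewrite cnorm_gt0 Bcplx_neq0.
    move: hj; rewrite Re_herglotz// ler_pdivlMr ?exprn_gt0// => hj.
    split=> //; rewrite cnormBC.
    have -> : K = (dl / ((m k)%:num * (N k)%:R)) / 2.
      by rewrite /K; field; rewrite !lt0r_neq0.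
    rewrite mulrAC ler_pdivrMr// (le_trans hj)// /depth.
    by have := cnorm_ge0 (cplx w); nra.
  apply: (@lt_le_trans _ _ ((m k)%:num *
      \sum_(j < N k) (dl / ((m k)%:num * (N k)%:R)))).
    rewrite ltr_pM2l//; apply: ltr_sum => //; first by apply/hasP; exists (Ordinal N0); rewrite ?mem_index_enum.
    by move=> j _; exact: small.
  rewrite sumr_const card_ord -[_ *+ N k]mulr_natl.
  rewrite le_eqVlt; apply/orP; left; apply/eqP; field.
  by rewrite !lt0r_neq0.
apply: (majorizedS cover (lexx _)).
apply: (@majorized_bigcup_lt _ _ _ _ _ (fun j => horodisk (root_point (N k) j) K)).
by move=> j jN; apply: majorizedS (VP j) => //; exact: VW.
Qed.

(** The condition on [dl] is what [preimage_horodisk] needs: the ratio of the total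
    mass of the stage to [dl] is at most [1/4]. *)
Lemma stage_sublevel_majorized k dl :
  0 < dl -> 4 * ((m k)%:num * (N k)%:R) <= dl ->
  maj (stage_sublevel k dl)
   ((N k)%:R * (horodisk_const p *
     ((N k)%:R / (24 * ((m k)%:num * (N k)%:R / dl))) `^ (p - 1))).
Proof.
move=> dl0 hdl; have m0 := mass_gt0 k.
have N0 := order_gt0 a14 ab k.
have NR : 0 < ((N k)%:R : R) by rewrite ltr0n.
set eps := (m k)%:num * (N k)%:R / dl.
have e0 : 0 < eps by rewrite divr_gt0// mulr_gt0.
have e4 : eps <= 4^-1 by rewrite ler_pdivrMr//; lra.
set K := (N k)%:R / (24 * eps).
have K4 : 4 <= K.
  have e24 : 0 < 24 * eps by rewrite mulr_gt0.
  rewrite /K ler_pdivlMr// orderE.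
  have := scale_exp_le (R := R) a14 ab (i := 0) (j := b) (c := 5) k.
  rewrite expr0 mulr1 -natrX => /(_ ltac:(lia)); set t := X k ^+ b; lra.
have cover : stage_sublevel k dl `<=` [set w | exists2 j, (j < N k)%N &
    horodisk (root_point (N k) j) K w].
  move=> w [d0 hw] /=.
  have z1 : cnorm (cplx w) < 1 by rewrite -depth_gt0.
  have zn := expc_neq1 N0 z1.
  have D0 : 0 < cnorm (1 - cplx w ^+ N k) by rewrite cnorm_gt0 subr_eq0 eq_sym.
  have [||j jN hj] := @preimage_horodisk _ (cplx w) (N k) eps N0 z1.
  - by rewrite e0.
  - move: hw; rewrite /stage_poisson mulrA ler_pdivlMr ?exprn_gt0// => hw.
    by rewrite /eps mulrAC ler_pdivlMr// mulrC.
  by exists j.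
apply: (majorizedS cover (lexx _)).
apply: (@majorized_bigcup_lt _ _ _ _ _ (fun j => horodisk (root_point (N k) j) K)).
move=> j jN; apply: horodisk_majorized => //; exact: unit_circle_root.
Qed.

(** The horodisks of stage [k] have [K >= (L / 96) x_k ^ (2 b - a - 1)], and there
    are [x_k ^ b] of them: the hypothesis relating [b], [a] and [p] makes the
    total cost at most a multiple of [1 / x_k]. *)
Lemma sublevel_cost_le (L : R) k : 0 < L ->
  (N k)%:R * (horodisk_const p *
     ((N k)%:R / (24 * ((m k)%:num * (N k)%:R / (L / 4 * 2^-1 ^+ k)))) `^ (p - 1))
  <= horodisk_const p * (L / 96) `^ (p - 1) * (X k)^-1.
Proof.
move=> L0; have X0 := scale_gt0 (R := R) a14 ab k.
have X1 := scale_ge1 (R := R) a14 ab k.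
have hc0 : 0 <= horodisk_const p.
  have /andP[q0 q1] := slice_ratio_bounds p_half.
  by rewrite !mulr_ge0 ?powR_ge0// invr_ge0 subr_ge0 ltW.
have p1 : 0 <= 1 - p by have := p_half; lra.
pose d := (2 * b - a - 1)%N.
set K := _ / (24 * _).
have Kge : L / 96 * X k ^+ d <= K.
  rewrite /K massM_orderE// orderE.
  have -> : X k ^+ b / (24 * (X k ^+ a / X k ^+ b / (L / 4 * 2^-1 ^+ k))) =
      L / 96 * (X k ^+ (2 * b) / (X k ^+ a * 2 ^+ k)).
    rewrite exprVn mul2n -addnn exprD; field.
    by rewrite !expf_neq0 ?lt0r_neq0// ?pnatr_eq0.
  rewrite ler_pM2l ?divr_gt0// ler_pdivlMr ?mulr_gt0 ?exprn_gt0//.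
  have -> : (2 * b = d + a + 1)%N by rewrite /d; move: ab; lia.
  rewrite !exprD expr1 mulrA ler_wpM2l ?mulr_ge0 ?exprn_ge0 ?(ltW X0)//.
  rewrite -natrX ler_nat (leq_trans _ (expn_leq_scale a14 ab k))// leq_exp2l//.
have c0 : 0 < L / 96 * X k ^+ d by rewrite mulr_gt0 ?divr_gt0// exprn_gt0.
have KV : K `^ (p - 1) <= (L / 96) `^ (p - 1) * (X k ^+ d) `^ (p - 1).
  rewrite -powRM ?divr_ge0 ?exprn_ge0 ?(ltW L0) ?(ltW X0)//.
  rewrite -[p - 1]opprB !powRN lef_pV2 ?posrE ?powR_gt0//; last exact: lt_le_trans Kge.
  apply: ge0_ler_powR => //; rewrite nnegrE ltW//.
  exact: lt_le_trans Kge.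
rewrite mulrCA -mulrA ler_wpM2l//.
apply: (@le_trans _ _ ((N k)%:R * ((L / 96) `^ (p - 1) * (X k ^+ d) `^ (p - 1)))).
  by rewrite ler_wpM2l.
rewrite mulrCA ler_wpM2l ?powR_ge0//.
rewrite orderE -!powR_mulrn ?(ltW X0)// -powRrM -powRD ?(lt0r_neq0 X0) ?implybT//.
rewrite -[leRHS]powR_inv1 ?(ltW X0)//; apply: ler_powR => //.
by have := bp; rewrite -/d -natr1; lra.
Qed.

(** Otherwise the real parts of the stages would add up to at most [L / 2]. *)
Lemma sublevel_cover (L : R) : 0 < L ->
  [set w | 0 < depth w /\ L <= Re (herglotz_int mu (cplx w))] `<=`
  \bigcup_k stage_sublevel k (L / 4 * 2^-1 ^+ k).
Proof.
move=> L0 w [d0 hL].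
have z1 : cnorm (cplx w) < 1 by rewrite -depth_gt0.
apply: contrapT => hno.
suff : Re (herglotz_int mu (cplx w)) <= L / 2 by lra.
apply: Re_herglotz_int_le => // [j|n]; first exact: (order_gt0 a14 ab).
apply: (@le_trans _ _ (\sum_(k < n) L / 2 * 2^-1 ^+ k.+1)).
  apply: ler_sum => k _; rewrite leNgt; apply/negP => h; apply: hno.
  exists (k : nat) => //; split=> //; apply: le_trans (ltW h).
  by rewrite exprS le_eqVlt; apply/orP; left; apply/eqP; field.
by rewrite -mulr_sumr ler_piMr ?geometric_half_sum// divr_ge0// ltW.
Qed.

(** Finitely many stages are too heavy for [stage_sublevel_majorized] at the
    given level; they only need a finite bound. *)
Lemma sublevel_majorized (L : R) : 0 < L ->
  exists V, maj [set w | 0 < depth w /\ L <= Re (herglotz_int mu (cplx w))] V.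
Proof.
move=> L0.
pose C1 := horodisk_const p * (L / 96) `^ (p - 1).
pose k0 := Num.truncn (16 / L).
have dl0 k : 0 < L / 4 * 2^-1 ^+ k by rewrite mulr_gt0 ?divr_gt0// exprn_gt0.
have ex k : exists V, maj (stage_sublevel k (L / 4 * 2^-1 ^+ k)) V /\
    ((k0 <= k)%N -> V <= C1 * (X k)^-1).
  have [kk|kk] := leqP k0 k; last first.
    have [V hV] := stage_sublevel_majorized_ex k (dl0 k).
    by exists V.
  eexists; split.
    apply: stage_sublevel_majorized => //.
    have X0 := scale_gt0 (R := R) a14 ab k.
    have X16 : 16 / L <= X k.
      apply: (@le_trans _ _ k0.+1%:R); first by apply: ltW; exact: truncnS_gt.
      by rewrite ler_nat (leq_trans _ (ltn_scale a14 ab k)).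
    apply: (@le_trans _ _ (4 * (X k ^+ 2)^-1)).
      rewrite ler_wpM2l// massM_orderE// ler_pdivrMr ?exprn_gt0//.
      rewrite ler_pdivlMl ?exprn_gt0// -exprD.
      have := scale_exp_le (R := R) a14 ab (i := 2 + a) (j := b) (c := 0) k.
      by rewrite expr0 mul1r; apply; move: ab; lia.
    apply: (@le_trans _ _ (L / 4 * (X k)^-1)); last first.
      rewrite ler_wpM2l ?divr_ge0 ?(ltW L0)// exprVn lef_pV2 ?posrE ?exprn_gt0//.
      by rewrite -natrX ler_nat (leq_trans _ (expn_leq_scale a14 ab k))// leq_exp2l.
    have XV : (X k)^-1 <= L / 16.
      by rewrite -[leRHS]invf_div lef_pV2 ?posrE ?divr_gt0.
    rewrite expr2 invfM mulrA ler_wpM2r ?invr_ge0 ?(ltW X0)//; lra.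
  by move=> _; exact: sublevel_cost_le.
have [V VP] := choice ex.
have V0 k : 0 <= V k by have [/majorized_ge0] := VP k.
pose W := \sum_(j < k0) V j.
have VW j : (j < k0)%N -> V j <= W.
  by move=> jk; rewrite /W (bigD1 (Ordinal jk))//= lerDl sumr_ge0.
have C10 : 0 <= C1.
  have /andP[q0 q1] := slice_ratio_bounds p_half.
  by rewrite !mulr_ge0 ?powR_ge0// invr_ge0 subr_ge0 ltW.
exists (k0%:R * W + C1).
apply: (majorizedS (sublevel_cover L0) (lexx _)).
apply: (@majorized_bigcup _ _ _ _ _ _ V); first by move=> k; have [] := VP k.
move=> n; apply: (@le_trans _ _ (\sum_(k < n) ((if (k < k0)%N then W else 0) + C1 * (X k)^-1))).
  apply: ler_sum => k _; case: ltnP => kk.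
    by rewrite ler_wpDr ?VW// mulr_ge0// invr_ge0.
  by rewrite add0r; have [_] := VP k; apply.
rewrite big_split/= sum_if_lt -mulr_sumr; apply: lerD.
  by rewrite ler_wpM2r ?sumr_ge0// ler_nat geq_minr.
by rewrite -[leRHS]mulr1 ler_wpM2l// (sum_scaleV_le a14 ab).
Qed.

Lemma sublevel_integral_lty (c : R) : 0 < c -> c < 1 ->
  (\int[area]_(w in [set w : plane | (cnorm (cplx w) < 1)%R /\
                       (cnorm (singular_inner mu (cplx w)) <= c)%R])
     (((1 - cnorm (cplx w)) `^ (1 + p))^-1)%:E < +oo)%E.
Proof.
move=> c0 c1; have L0 : 0 < - ln c by rewrite oppr_gt0 ln_lt0// c0.
have [V hV] := sublevel_majorized L0.
apply: (@le_lt_trans _ _ V%:E); last exact: ltry.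
apply: majorized_integral => [w _|]; first by rewrite lee_fin invr_ge0 powR_ge0.
apply: majorizedS hV => // w [w1 h]; rewrite cnorm_singular_inner in h.
split; first by rewrite depth_gt0.
by rewrite lerNl -ler_expR lnK.
Qed.

End Sublevel.

(** * Singularity and conclusion *)

Section Singularity.
Context {R : realType} (m : nat -> {nonneg R}) (N : nat -> nat).

Definition atoms : set (@plane R) :=
  \bigcup_k \bigcup_j [set root_point (N k) j].

Lemma measurable_atoms : measurable atoms.
Proof.
apply: bigcupT_measurable => k; apply: bigcupT_measurable => j.
rewrite (_ : [set _] = [set (root_point (N k) j).1] `*` [set (root_point (N k) j).2]).
  by apply: measurableX; exact: measurable_set1.
apply/seteqP; split=> [w ->//|[u v] [/= -> ->]].
exact: erefl.
Qed.

Lemma atomic_measure_eq0 (A : set (@plane R)) :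
  (forall k j, ~ A (root_point (N k) j)) -> atomic_measure m N A = 0%E.
Proof.
move=> An; rewrite /atomic_measure /mseries.
rewrite eseries0// => k _ _; rewrite stage_measureE big1 ?mule0// => j _.
by rewrite diracE memNset.
Qed.

(** Each atom is the image of at most two angles, [acos c] and [2 pi - acos c],
    where [c] is its abscissa. *)
Lemma arc_length_atoms : arc_length atoms = 0%E.
Proof.
rewrite /arc_length /pushforward /mrestr; apply: countable_lebesgue_measure0.
rewrite /atoms preimage_bigcup setI_bigcupl; apply: bigcup_countable => // k _.
rewrite preimage_bigcup setI_bigcupl; apply: bigcup_countable => // j _.
pose c : R := (root_point (N k) j).1.
apply: (@sub_countable _ _ _ [set acos c; 2 * pi - acos c]); last first.
  exact/finite_set_countable/finite_set2.
apply: subset_card_le => t [/= tE]; rewrite in_itv/= => /andP[t0 t2].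
have ct : cos t = c by rewrite /c -tE.
have [tp|tp] := lerP t pi; [left|right].
  by rewrite -ct cosK// in_itv/= t0.
rewrite /= -ct -[cos t]cosN -(cosD2pi (- t)) cosK.
  by rewrite mulr2n; ring.
by rewrite in_itv/= mulr2n; apply/andP; split; lra.
Qed.

End Singularity.

Lemma exists_nat_ge (R : realType) (x : R) : exists n : nat, x <= n%:R.
Proof. by exists (Num.truncn x).+1; exact/ltW/truncnS_gt. Qed.

Theorem lemma6p2 (R : realType) (p : R) (hp0 : 0 < p) (hp : p < 1 / 2) :
  exists mu : {finite_measure set (@plane R) -> \bar R},
    [/\ mu (~` unit_circle) = 0%E,
        mutually_singular mu arc_length,
        ~ Hardy p (cderive (singular_inner mu)) &
        forall c : R, 0 < c -> c < 1 ->
          (\int[area]_(w in [set w : plane | (cnorm (cplx w) < 1)%R /\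
                             (cnorm (singular_inner mu (cplx w)) <= c)%R])
             (((1 - cnorm (cplx w)) `^ (1 + p))^-1)%:E < +oo)%E].
Proof.
(* [a] makes the integral means diverge; [b], chosen after [a], makes the costs
   of the sublevel sets summable, which is possible since [1 - 2 p > 0]. *)
have [a0 ha0] := exists_nat_ge (2 / p).
pose a := (14 + a0)%N.
have a14 : (14 <= a)%N by exact: leq_addr.
have ap : 2 <= a%:R * p.
  rewrite -ler_pdivrMr// (le_trans ha0)// ler_nat; exact: leq_addl.
have q0 : 0 < 1 - 2 * p by lra.
have [b0 hb0] := exists_nat_ge (a.+2%:R / (1 - 2 * p)).
pose b := (a.+2 + b0)%N.
have ab : (a.+2 <= b)%N by exact: leq_addr.
have bq : a.+2%:R <= b%:R * (1 - 2 * p).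
  rewrite -ler_pdivrMr// (le_trans hb0)// ler_nat; exact: leq_addl.
have bp : b.+1%:R <= (2 * b - a - 1)%:R * (1 - p).
  have -> : ((2 * b - a - 1)%:R : R) = 2 * b%:R - a%:R - 1.
    by rewrite -natrM !natrB//; move: ab; lia.
  have a_ge0 : 0 <= (a%:R : R) by [].
  move: bq; rewrite -[b.+1%:R]natr1 -[a.+2%:R]natr1 -[a.+1%:R]natr1.
  move: (b%:R : R) => y; move: (a%:R : R) a_ge0 => x x0; nra.
exists (finite_atomic (sum_massM_order_le (R := R) a14 ab)); split.
- by apply: atomic_measure_eq0 => k j /=; apply; exact: unit_circle_root.
- exists (~` @atoms R (order b)); split.
  + by apply: measurableC; exact: measurable_atoms.
  + by apply: atomic_measure_eq0 => k j /=; apply; exists k => //; exists j.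
  + by rewrite setCK arc_length_atoms.
- exact: not_Hardy_cderive.
- by move=> c c0 c1; exact: sublevel_integral_lty.
Qed.
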